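(* MEFE-Matching can be solved in $\mathrm{FPT}(m)$, where $m$ is the number of TAs. That is, there are a computable function $f$ and an algorithm that, given an instance $I$ with $m$ TAs, runs in time $f(m)\cdot|I|^{O(1)}$ and outputs a MEFE matching if one exists and correctly reports that none exists otherwise.
   Context: An instance of MEFE-Matching consists of: a finite set of courses $X=\{x_1,\dots,x_n\}$; a finite set of TAs $T=\{t_1,\dots,t_m\}$; for each TA $t_i$ a utility (valuation) function $u_i=u_{t_i}\colon X\to\mathbb{Z}_{\ge 0}$ and a grade function $g_i=g_{t_i}\colon X\to\mathbb{Q}_{\ge 0}$; for each course $x_i$ a capacity $c_i$ (a positive integer) and a utility (valuation) function $v_i=v_{x_i}\colon T\to\mathbb{Z}_{\ge 0}$, where for every TA $t$ and course $x_i$ one has $v_i(t)=0$ if $u_t(x_i)=0$ and $v_i(t)>0$ otherwise; and a number $k\in\mathbb{Q}_{\ge 0}$. All numbers are encoded in binary; $|I|$ denotes the encoding length of the instance $I$. A matching is a function $\mu\colon T\to X\cup\{\emptyset\}$, where $\mu(t)=\emptyset$ means $t$ is unassigned; by convention $u_t(\emptyset)=0$. It is feasible if $|\mu^{-1}(x_i)|=c_i$ for every course $x_i$ and no TA $t$ is assigned to a course $x$ with $u_t(x)=0$. A MEFE (merit-based envy-free egalitarian) matching is a feasible matching $\mu$ such that (1) (satisfaction of courses) for every course $x_i$, $\mathrm{AvgUtil}(x_i)=\frac{1}{c_i}\sum_{t\in\mu^{-1}(x_i)}v_i(t)\ge k$; and (2) (merit-based envy-freeness) there are no two TAs $t_i,t_j$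 with $\mu(t_j)\in X$, $g_i(\mu(t_j))\ge g_j(\mu(t_j))$ and $u_i(\mu(t_j))>u_i(\mu(t_i))$. *)

(* Defs.v *)
From mathcomp Require Import all_boot all_order all_algebra.
Set Implicit Arguments.
Unset Strict Implicit.
Unset Printing Implicit Defensive.
Import Order.TTheory GRing.Theory Num.Theory.

(** * Model of computation

    The random access machine of Aho, Hopcroft and Ullman, "The Design and
    Analysis of Computer Algorithms", Sections 1.2-1.3, over the natural
    numbers (subtraction is cut off at 0, and there is no division), with
    a read-only input tape, a write-only output tape, and register 0 as the
    accumulator.  Running time is measured by the logarithmic cost criterion,
    under which the machine is polynomially related to multitape Turing
    machines. *)

Inductive address :=
| Direct of nat      (* the register numbered i *)
| Indirect of nat.   (* the register whose number is stored in register i *)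

Inductive operand :=
| Literal of nat
| Content of address.

Inductive instruction :=
| LOAD of operand
| STORE of address
| ADD of operand
| SUB of operand
| MULT of operand
| READ of address
| WRITE of operand
| JUMP of nat
| JGTZ of nat
| JZERO of nat
| HALT.

Definition program := seq instruction.

Record config := Config {
  pc : nat;
  mem : nat -> nat;
  input : seq nat;    (* the unread part of the input tape *)
  output : seq nat
}.

Definition bitlen (n : nat) : nat := (trunc_log 2 n).+1.

Definition target (M : nat -> nat) (a : address) : nat :=
  match a with Direct i => i | Indirect i => M i end.

Definition target_cost (M : nat -> nat) (a : address) : nat :=
  match a with
  | Direct i => bitlen i
  | Indirect i => bitlen i + bitlen (M i)
  end.

Definition value (M : nat -> nat) (o : operand) : nat :=
  match o with Literal i => i | Content a => M (target M a) end.

Definition value_cost (M : nat -> nat) (o : operand) : nat :=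
  match o with
  | Literal i => bitlen i
  | Content a => target_cost M a + bitlen (M (target M a))
  end.

Definition update (M : nat -> nat) (i x : nat) : nat -> nat :=
  fun j => if j == i then x else M j.

(* Running off the end of the program is the same as [HALT]. *)
Definition current (P : program) (s : config) : instruction :=
  nth HALT P (pc s).

(* [None] means that the machine stops; reading past the end of the input
   yields 0. *)
Definition step (P : program) (s : config) : option config :=
  let: Config p M inp out := s in
  match current P s with
  | LOAD o => Some (Config p.+1 (update M 0 (value M o)) inp out)
  | STORE a => Some (Config p.+1 (update M (target M a) (M 0)) inp out)
  | ADD o => Some (Config p.+1 (update M 0 (M 0 + value M o)) inp out)
  | SUB o => Some (Config p.+1 (update M 0 (M 0 - value M o)) inp out)
  | MULT o => Some (Config p.+1 (update M 0 (M 0 * value M o)) inp out)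
  | READ a =>
      Some (Config p.+1 (update M (target M a) (head 0 inp)) (behead inp) out)
  | WRITE o => Some (Config p.+1 M inp (rcons out (value M o)))
  | JUMP q => Some (Config q M inp out)
  | JGTZ q => Some (Config (if 0 < M 0 then q else p.+1) M inp out)
  | JZERO q => Some (Config (if M 0 == 0 then q else p.+1) M inp out)
  | HALT => None
  end.

Definition step_cost (P : program) (s : config) : nat :=
  let M := mem s in
  match current P s with
  | LOAD o | WRITE o => value_cost M o
  | STORE a => bitlen (M 0) + target_cost M a
  | ADD o | SUB o | MULT o => bitlen (M 0) + value_cost M o
  | READ a => bitlen (head 0 (input s)) + target_cost M a
  | JGTZ _ | JZERO _ => bitlen (M 0)
  | JUMP _ | HALT => 1
  end.

(* [runs P s t out]: started in [s], [P] halts after total cost [t] with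
   [out] on its output tape. *)
Inductive runs (P : program) : config -> nat -> seq nat -> Prop :=
| runs_halt s :
    step P s = None -> runs P s (step_cost P s) (output s)
| runs_step s s' t out :
    step P s = Some s' -> runs P s' t out ->
    runs P s (step_cost P s + t) out.

Definition computes_in (P : program) (inp : seq nat) (t : nat)
    (out : seq nat) : Prop :=
  runs P (Config 0 (fun=> 0) inp [::]) t out.

Definition computable (f : nat -> nat) : Prop :=
  exists P : program, forall n, exists t, computes_in P [:: n] t [:: f n].

(** * MEFE-Matching *)

Local Open Scope ring_scope.

Record instance := Instance {
  ncourses : nat;
  ntas : nat;
  u : 'I_ntas -> 'I_ncourses -> nat;
  g : 'I_ntas -> 'I_ncourses -> rat;
  cap : 'I_ncourses -> nat;
  v : 'I_ncourses -> 'I_ntas -> nat;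
  k : rat;
  g_ge0 : forall t x, 0 <= g t x;
  cap_gt0 : forall x, (0 < cap x)%N;
  v_eq0 : forall x t, u t x = 0%N -> v x t = 0%N;
  v_gt0 : forall x t, u t x <> 0%N -> (0 < v x t)%N;
  k_ge0 : 0 <= k
}.

(* [None] is the unassigned option. *)
Definition matching (I : instance) : Type :=
  {ffun 'I_(ntas I) -> option 'I_(ncourses I)}.

Definition util (I : instance) (t : 'I_(ntas I))
    (y : option 'I_(ncourses I)) : nat :=
  if y is Some x then u t x else 0%N.

Definition feasible (I : instance) (mu : matching I) : Prop :=
  (forall x, #|[set t | mu t == Some x]| = cap x) /\
  ~ (exists t x, mu t = Some x /\ u t x = 0%N).

Definition avg_util (I : instance) (mu : matching I)
    (x : 'I_(ncourses I)) : rat :=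
  (cap x)%:R^-1 * \sum_(t | mu t == Some x) (v x t)%:R.

Definition courses_satisfied (I : instance) (mu : matching I) : Prop :=
  forall x, k I <= avg_util mu x.

Definition merit_envy_free (I : instance) (mu : matching I) : Prop :=
  ~ (exists ti tj x,
       [/\ mu tj = Some x, g tj x <= g ti x
         & (util ti (mu ti) < util ti (mu tj))%N]).

Definition MEFE (I : instance) (mu : matching I) : Prop :=
  [/\ feasible mu, courses_satisfied mu & merit_envy_free mu].

(** * Encodings *)

(* Only applied to nonnegative rationals: numerator and denominator in lowest
   terms. *)
Definition encode_rat (q : rat) : seq nat :=
  [:: absz (numq q); absz (denq q)].

Definition encode (I : instance) : seq nat :=
  [:: ncourses I; ntas I]
  ++ [seq u t x | t <- enum 'I_(ntas I), x <- enum 'I_(ncourses I)]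
  ++ flatten [seq encode_rat (g t x) | t <- enum 'I_(ntas I),
                                       x <- enum 'I_(ncourses I)]
  ++ [seq cap x | x <- enum 'I_(ncourses I)]
  ++ [seq v x t | x <- enum 'I_(ncourses I), t <- enum 'I_(ntas I)]
  ++ encode_rat (k I).

(* The encoding length |I|: total number of binary digits. *)
Definition isize (I : instance) : nat :=
  (\sum_(w <- encode I) bitlen w)%N.

(* "No" is the output 0; otherwise the output is 1 followed, for each TA, by 0
   if it is unassigned and by j + 1 if it is assigned to course j. *)
Definition encode_answer (I : instance) (r : option (matching I)) : seq nat :=
  if r is Some mu then
    1%N :: [seq (if mu t is Some x then (x : nat).+1 else 0%N)
           | t <- enum 'I_(ntas I)]
  else [:: 0%N].

Definition correct_answer (I : instance) (r : option (matching I)) : Prop :=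
  match r with
  | Some mu => MEFE mu
  | None => ~ exists mu : matching I, MEFE mu
  end.

(* Main.v *)
(** If there are more courses than TAs, no matching is feasible, since every
    course takes at least one TA.  Otherwise the number n of courses is at most
    the number m of TAs, and exhaustive search over the (n+1)^m assignments
    (numbered by their base n+1 digits) takes a number of arithmetic operations
    that depends on m only.  All numbers handled are bounded by a function of m
    times 2^|I|, so under logarithmic cost each operation costs O(f(m) |I|); the
    averages and grades are compared by cross-multiplication, which avoids
    division.  To obtain an actual RAM program, the search is written in a small
    language whose only loops are counted loops, so that the number of steps has
    a static bound, and the language is compiled to the RAM. *)

Require Import Defs.
From mathcomp Require Import all_boot all_order all_algebra.
From mathcomp Require Import zify.
Set Implicit Arguments.
Unset Strict Implicit.
Unset Printing Implicit Defensive.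

(** * A language of counted loops and its compilation to the RAM *)

(** Logarithmic cost needs a bound on every number and address at every machine step. The work is
    split so that this is settled mostly by syntax. Only two dynamic bounds enter the weakest
    preconditions of source programs: stored values are at most [W], and loops take at most [Z]
    rounds. Transient quantities (intermediate values, register numbers) are then at most [W ^ S],
    where [S] bounds the syntactic size of expressions, and the number of steps is bounded by a
    function of the program text and [Z]. The machine is met again only through [wp_computes];
    verifying the search means proving its result together with the bounds [W] and [Z]. Here [Z]
    depends on [m] only, while [W] carries the factor [2 ^ isize I]. Since [W] enters the cost
    through its bit length, the running time is linear in the encoding length, and the exponent [c]
    of the theorem is 1. The time bound [f] must be computable too; a program for it is verified by
    the same route. *)

Lemma bitlen_mono a b : a <= b -> bitlen a <= bitlen b.
Proof. by move=> ab; rewrite /bitlen ltnS leq_trunc_log. Qed.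

Lemma ltn_bitlen a : a < 2 ^ bitlen a.
Proof. exact: trunc_log_ltn. Qed.

(** The case [a = 0] is what requires [0 < j], because [bitlen 0 = 1]. *)
Lemma bitlen_leq a j : 0 < j -> a < 2 ^ j -> bitlen a <= j.
Proof.
move=> j0; case: (posnP a) => [->|a0] aj; first by rewrite /bitlen trunc_log0.
rewrite /bitlen -(@ltn_exp2l 2) //.
by apply: leq_ltn_trans aj; apply: trunc_logP.
Qed.

Lemma bitlenM a b : bitlen (a * b) <= bitlen a + bitlen b.
Proof.
apply: bitlen_leq; first by rewrite addn_gt0.
by rewrite expnD ltn_mul ?ltn_bitlen.
Qed.

Lemma bitlenX a j : 0 < j -> bitlen (a ^ j) <= j * bitlen a.
Proof.
case: j => // j _; elim: j => [|j IH]; first by rewrite expn1 mul1n.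
by rewrite expnS mulSn; apply: leq_trans (bitlenM _ _) _; rewrite leq_add2l.
Qed.

(** * Step-counted runs of the machine *)

Section Runs.

Variables (P : program) (L : nat).

(** Steps are counted and each is charged at most [L], so that the compiler proof deals with step
    counts only; [go_runs] converts them to cost, its final 1 being the cost of [HALT]. *)
Inductive go : nat -> config -> config -> Prop :=
| go0 s : go 0 s s
| goS k s s' s'' :
    step P s = Some s' -> step_cost P s <= L -> go k s' s'' -> go k.+1 s s''.

Lemma go_trans k1 k2 s1 s2 s3 : go k1 s1 s2 -> go k2 s2 s3 -> go (k1 + k2) s1 s3.
Proof.
move=> H; elim: H s3 => // k s s' s'' st sc _ IH s3 H3.
by rewrite addSn; apply: goS st sc (IH _ H3).
Qed.

Lemma go_runs k s s' :
  go k s s' -> current P s' = HALT ->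
  exists2 t, runs P s t (output s') & t <= k * L + 1.
Proof.
elim=> {k s s'} [s|k s s' s'' st cst _ IH] halt.
  have H : step P s = None by case: s halt => p M i o; rewrite /step => ->.
  by exists (step_cost P s); [apply: runs_halt|rewrite /step_cost halt].
have [t r le] := IH halt; exists (step_cost P s + t).
  exact: runs_step st r.
by rewrite mulSn -addnA leq_add.
Qed.

Fixpoint code_at p (code : program) : Prop :=
  if code is ins :: code' then nth HALT P p = ins /\ code_at p.+1 code' else True.

Lemma code_at_cat p c1 c2 :
  code_at p (c1 ++ c2) <-> code_at p c1 /\ code_at (p + size c1) c2.
Proof.
elim: c1 p => [|i c1 IH] p /=; first by rewrite addn0; tauto.
by rewrite IH addnS addSn; tauto.
Qed.

End Runs.

Lemma code_at_self P : code_at P 0 P.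
Proof.
suff H : forall c pre, code_at (pre ++ c) (size pre) c by apply: (H P [::]).
elim=> // i c IH pre; split; first by rewrite nth_cat ltnn subnn.
by have := IH (rcons pre i); rewrite cat_rcons size_rcons.
Qed.

(** * Source language and compiler *)

Inductive expr :=
| Lit of nat
| Var of nat
| Get of expr
| Plus of expr & expr
| Minus of expr & expr
| Times of expr & expr.

(* [For x e b] evaluates [e] once and then runs [b] with [x] = 0, 1, ... below
   that value; on exit [x] holds the value of [e]. *)
Inductive cmd :=
| Skip
| Assign of nat & expr
| Put of expr & expr
| Read of nat
| Write of expr
| Seq of cmd & cmd
| If of expr & cmd & cmd
| For of nat & expr & cmd.

Record state := State {
  sc : nat -> nat;
  hp : nat -> nat;
  inp : seq nat;
  out : seq nat
}.

Definition setv s x a := State (update (sc s) x a) (hp s) (inp s) (out s).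
Definition seth s h a := State (sc s) (update (hp s) h a) (inp s) (out s).

Fixpoint eval e s : nat :=
  match e with
  | Lit n => n
  | Var x => sc s x
  | Get e => hp s (eval e s)
  | Plus e1 e2 => eval e1 s + eval e2 s
  | Minus e1 e2 => eval e1 s - eval e2 s
  | Times e1 e2 => eval e1 s * eval e2 s
  end.

(* Register 0 is the accumulator.  The other registers are interleaved modulo 4:
   evaluation stack, scalar variables, (hidden) loop limits, heap. *)
Definition tmp d := 4 * d + 1.
Definition var x := 4 * x + 2.
Definition lim x := 4 * x + 3.
Definition cell h := 4 * h + 4.

(** The right operand is evaluated first and parked in [tmp d], so that the left one ends in the
    accumulator, as [SUB] requires. The depth rises only for the left operand, since the right one
    is finished before [tmp d] is filled. *)
Fixpoint cexpr d e : program :=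
  match e with
  | Lit n => [:: LOAD (Literal n)]
  | Var x => [:: LOAD (Content (Direct (var x)))]
  | Get e => cexpr d e ++
      [:: MULT (Literal 4); ADD (Literal 4); STORE (Direct (tmp d));
          LOAD (Content (Indirect (tmp d)))]
  | Plus e1 e2 => cexpr d e2 ++ STORE (Direct (tmp d)) :: cexpr d.+1 e1 ++
      [:: ADD (Content (Direct (tmp d)))]
  | Minus e1 e2 => cexpr d e2 ++ STORE (Direct (tmp d)) :: cexpr d.+1 e1 ++
      [:: SUB (Content (Direct (tmp d)))]
  | Times e1 e2 => cexpr d e2 ++ STORE (Direct (tmp d)) :: cexpr d.+1 e1 ++
      [:: MULT (Content (Direct (tmp d)))]
  end.

(** Jumps are absolute, hence the start address [p]. A loop keeps its limit in the register [lim x],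
    out of reach of the body, and leaves when limit minus counter is 0. *)
Fixpoint compile p c : program :=
  match c with
  | Skip => [::]
  | Assign x e => cexpr 0 e ++ [:: STORE (Direct (var x))]
  | Put e1 e2 => cexpr 0 e2 ++ STORE (Direct (tmp 0)) :: cexpr 1 e1 ++
      [:: MULT (Literal 4); ADD (Literal 4); STORE (Direct (tmp 1));
          LOAD (Content (Direct (tmp 0))); STORE (Indirect (tmp 1))]
  | Read x => [:: READ (Direct (var x))]
  | Write e => cexpr 0 e ++ [:: WRITE (Content (Direct 0))]
  | Seq c1 c2 =>
      let k1 := compile p c1 in k1 ++ compile (p + size k1) c2
  | If e c1 c2 =>
      let ke := cexpr 0 e in
      let k1 := compile (p + size ke).+1 c1 in
      let q := ((p + size ke).+1 + size k1).+1 in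
      let k2 := compile q c2 in
      ke ++ JZERO q :: k1 ++ JUMP (q + size k2) :: k2
  | For x e b =>
      let ke := cexpr 0 e in
      let top := (p + size ke).+3 in
      let kb := compile top.+3 b in
      ke ++ [:: STORE (Direct (lim x)); LOAD (Literal 0); STORE (Direct (var x));
                LOAD (Content (Direct (lim x))); SUB (Content (Direct (var x)));
                JZERO (top.+3 + size kb + 4)]
         ++ kb ++
         [:: LOAD (Content (Direct (var x))); ADD (Literal 1);
             STORE (Direct (var x)); JUMP top]
  end.

(** Accumulator, stack and loop limits are left unconstrained; the limits are followed separately in
    [simulates]. *)
Definition rel s (M : nat -> nat) :=
  (forall x, M (var x) = sc s x) /\ (forall h, M (cell h) = hp s h).

(* Every value and every address met while evaluating [e] is at most [V]. *)
Fixpoint ebnd V d e s : bool :=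
  match e with
  | Lit n => n <= V
  | Var x => (var x <= V) && (sc s x <= V)
  | Get e' => [&& ebnd V d e' s, tmp d <= V, cell (eval e' s) <= V & eval e s <= V]
  | Plus e1 e2 | Minus e1 e2 | Times e1 e2 =>
      [&& ebnd V d e2 s, ebnd V d.+1 e1 s, tmp d <= V & eval e s <= V]
  end.

Lemma ebnd_eval V d e s : ebnd V d e s -> eval e s <= V.
Proof. by case: e => //= [x /andP[]|e /and4P[]|e e' /and4P[]|e e' /and4P[]|e e' /and4P[]]. Qed.

Lemma update_eq M i x : update M i x i = x.
Proof. by rewrite /update eqxx. Qed.

Lemma update_neq M i x j : j <> i -> update M i x j = M j.
Proof. by move=> /eqP/negbTE ne; rewrite /update ne. Qed.

(** The register classes differ modulo 4, and cells start at 4, above the accumulator, so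
    disjointness is linear arithmetic. *)
Ltac addr := rewrite /var /cell /tmp /lim in |- *; lia.
Ltac upd := repeat (rewrite update_eq || (rewrite update_neq; last by addr)).

(** * Correctness of compiled expressions *)

Section Expr.
Variables (P : program) (V : nat).
Hypothesis V4 : 4 <= V.
(** No instruction charges for more than four numbers, so a step that meets only numbers up to [V]
    costs at most [L]. *)
Let L := 4 * bitlen V.

Lemma cost1 a : a <= V -> bitlen a <= L.
Proof. by move=> /bitlen_mono le; rewrite /L; lia. Qed.
Lemma cost2 a b : a <= V -> b <= V -> bitlen a + bitlen b <= L.
Proof. by move=> /bitlen_mono la /bitlen_mono lb; rewrite /L; lia. Qed.
Lemma cost3 a b c : a <= V -> b <= V -> c <= V -> bitlen a + bitlen b + bitlen c <= L.
Proof. by move=> /bitlen_mono la /bitlen_mono lb /bitlen_mono lc; rewrite /L; lia. Qed.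
Lemma cost3' a b c : a <= V -> b <= V -> c <= V -> bitlen a + (bitlen b + bitlen c) <= L.
Proof. by rewrite addnA; apply: cost3. Qed.
Lemma cost0 : 1 <= L.
Proof. by rewrite /L /bitlen; lia. Qed.

Lemma go_load k p M i o src s' :
  nth HALT P p = LOAD src -> value_cost M src <= L ->
  go P L k (Config p.+1 (update M 0 (value M src)) i o) s' ->
  go P L k.+1 (Config p M i o) s'.
Proof. by move=> H c; apply: goS; rewrite /step /step_cost /current /= H. Qed.

Lemma go_store k p M i o a s' :
  nth HALT P p = STORE a -> bitlen (M 0) + target_cost M a <= L ->
  go P L k (Config p.+1 (update M (target M a) (M 0)) i o) s' ->
  go P L k.+1 (Config p M i o) s'.
Proof. by move=> H c; apply: goS; rewrite /step /step_cost /current /= H. Qed.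

Lemma go_add k p M i o src s' :
  nth HALT P p = ADD src -> bitlen (M 0) + value_cost M src <= L ->
  go P L k (Config p.+1 (update M 0 (M 0 + value M src)) i o) s' ->
  go P L k.+1 (Config p M i o) s'.
Proof. by move=> H c; apply: goS; rewrite /step /step_cost /current /= H. Qed.

Lemma go_sub k p M i o src s' :
  nth HALT P p = SUB src -> bitlen (M 0) + value_cost M src <= L ->
  go P L k (Config p.+1 (update M 0 (M 0 - value M src)) i o) s' ->
  go P L k.+1 (Config p M i o) s'.
Proof. by move=> H c; apply: goS; rewrite /step /step_cost /current /= H. Qed.

Lemma go_mult k p M i o src s' :
  nth HALT P p = MULT src -> bitlen (M 0) + value_cost M src <= L ->
  go P L k (Config p.+1 (update M 0 (M 0 * value M src)) i o) s' ->
  go P L k.+1 (Config p M i o) s'.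
Proof. by move=> H c; apply: goS; rewrite /step /step_cost /current /= H. Qed.

Lemma go_jump k p M i o q s' :
  nth HALT P p = JUMP q ->
  go P L k (Config q M i o) s' -> go P L k.+1 (Config p M i o) s'.
Proof. by move=> H; apply: goS; rewrite /step /step_cost /current /= H ?cost0. Qed.

Lemma go_jzero k p M i o q s' :
  nth HALT P p = JZERO q -> bitlen (M 0) <= L ->
  go P L k (Config (if M 0 == 0 then q else p.+1) M i o) s' ->
  go P L k.+1 (Config p M i o) s'.
Proof. by move=> H c; apply: goS; rewrite /step /step_cost /current /= H. Qed.

(** The registers that code compiled at depth [d] may overwrite: the accumulator and the stack from
    level [d] upwards. *)
Definition scratch d a := (a == 0) || (tmp d <= a) && (a %% 4 == 1).

Lemma go_expr s e : forall d p M i o,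
  code_at P p (cexpr d e) -> rel s M -> ebnd V d e s ->
  exists M', [/\ go P L (size (cexpr d e)) (Config p M i o)
                    (Config (p + size (cexpr d e)) M' i o),
                 M' 0 = eval e s &
                 forall a, ~~ scratch d a -> M' a = M a].
Proof.
have relS d M M' : rel s M -> (forall a, ~~ scratch d a -> M' a = M a) -> rel s M'.
  move=> [Hv Hh] E; split=> [x|h]; rewrite E ?Hv ?Hh // /scratch; addr.
(* The three binary operations differ only in the instruction [op] and its meaning [f], so one
   argument serves them all, with the induction hypotheses passed in. *)
have bin e1 e2 d p M i o op (f : nat -> nat -> nat) :
    (forall k p M i o src s', nth HALT P p = op src -> bitlen (M 0) + value_cost M src <= L ->
     go P L k (Config p.+1 (update M 0 (f (M 0) (value M src))) i o) s' ->
     go P L k.+1 (Config p M i o) s') ->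
    (forall d p M i o, code_at P p (cexpr d e1) -> rel s M -> ebnd V d e1 s ->
      exists M', [/\ go P L (size (cexpr d e1)) (Config p M i o)
                    (Config (p + size (cexpr d e1)) M' i o),
                 M' 0 = eval e1 s & forall a, ~~ scratch d a -> M' a = M a]) ->
    (forall d p M i o, code_at P p (cexpr d e2) -> rel s M -> ebnd V d e2 s ->
      exists M', [/\ go P L (size (cexpr d e2)) (Config p M i o)
                    (Config (p + size (cexpr d e2)) M' i o),
                 M' 0 = eval e2 s & forall a, ~~ scratch d a -> M' a = M a]) ->
    let code := cexpr d e2 ++ STORE (Direct (tmp d)) :: cexpr d.+1 e1 ++
                [:: op (Content (Direct (tmp d)))] in
    code_at P p code -> rel s M ->
    [&& ebnd V d e2 s, ebnd V d.+1 e1 s, tmp d <= V & f (eval e1 s) (eval e2 s) <= V] ->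
    exists M', [/\ go P L (size code) (Config p M i o) (Config (p + size code) M' i o),
                 M' 0 = f (eval e1 s) (eval e2 s) & forall a, ~~ scratch d a -> M' a = M a].
  move=> Hop IH1 IH2 code; rewrite /code => /code_at_cat[C2 /= [Cs /code_at_cat[C1 [Co _]]]] R.
  move=> /and4P[b2 b1 bt bv].
  have [M2 [G2 E2 K2]] := IH2 d p M i o C2 R b2.
  pose M3 := update M2 (tmp d) (M2 0).
  have R3 : rel s M3.
    apply: (relS d M) => // a Ha; rewrite /M3 update_neq ?K2 //.
    by move: Ha; rewrite /scratch; addr.
  have [M1 [G1 E1 K1]] := IH1 d.+1 _ M3 i o C1 R3 b1.
  exists (update M1 0 (f (eval e1 s) (eval e2 s))); split.
  - have -> : size code = size (cexpr d e2) + (size (cexpr d.+1 e1) + 1).+1.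
      by rewrite /code size_cat /= size_cat.
    apply: go_trans G2 _; apply: go_store; first exact: Cs.
      by rewrite /= E2; apply: cost2 => //; apply: ebnd_eval b2.
    apply: go_trans G1 _.
    (* The parked operand survives because [e1] runs at depth [d.+1], whose scratch registers
       exclude [tmp d]. *)
    have E3 : M1 (tmp d) = eval e2 s.
      by rewrite K1 /M3 ?update_eq // /scratch; addr.
    apply: Hop; first exact: Co.
      by rewrite /= E1 E3; apply: cost3' => //; [apply: ebnd_eval b1|apply: ebnd_eval b2].
    rewrite /= E1 E3.
    have -> : ((p + size (cexpr d e2)).+1 + size (cexpr d.+1 e1)).+1 =
       p + (size (cexpr d e2) + (size (cexpr d.+1 e1) + 1).+1) by lia.
    exact: go0.
  - exact: update_eq.
  - move=> a Ha; rewrite update_neq; last by move: Ha; rewrite /scratch; lia.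
    rewrite K1; last by move: Ha; rewrite /scratch; addr.
    rewrite /M3 update_neq ?K2 //.
    by move: Ha; rewrite /scratch; addr.
elim: e => [n|x|e IH|e1 IH1 e2 IH2|e1 IH1 e2 IH2|e1 IH1 e2 IH2] d p M i o.
- move=> /= [C _] R b; exists (update M 0 n); split.
  + by rewrite addn1; apply: go_load => //=; [exact: C | apply: cost1 | apply: go0].
  + exact: update_eq.
  + by move=> a Ha; rewrite update_neq //; move: Ha; rewrite /scratch; lia.
- move=> /= [C _] R /andP[b b']; exists (update M 0 (sc s x)); split.
  + rewrite addn1; apply: go_load => //=; [exact: C | |].
      by rewrite /= R.1; apply: cost2.
    by rewrite /= R.1; apply: go0.
  + exact: update_eq.
  + by move=> a Ha; rewrite update_neq //; move: Ha; rewrite /scratch; lia.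
- move=> /code_at_cat[C /= [C1 [C2 [C3 [C4 _]]]]] R /and4P[b bt bc bv].
  have [M1 [G1 E1 K1]] := IH d p M i o C R b.
  pose M2 := update (update M1 0 (eval e s * 4)) 0 (cell (eval e s)).
  pose M3 := update M2 (tmp d) (cell (eval e s)).
  exists (update M3 0 (hp s (eval e s))); split.
  + rewrite size_cat; apply: go_trans G1 _ => /=.
    have b4 : eval e s * 4 <= V by move: bc; rewrite /cell; lia.
    have ce : eval e s * 4 + 4 = cell (eval e s) by rewrite /cell; lia.
    apply: go_mult; first exact: C1.
      by rewrite /= E1; apply: cost2 => //; lia.
    rewrite /= E1.
    apply: go_add; first exact: C2.
      by rewrite /= !update_eq; apply: cost2.
    rewrite /= !update_eq ce -/M2.
    apply: go_store; first exact: C3.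
      by rewrite /= {1}/M2 update_eq; apply: cost2.
    rewrite /= {2}/M2 update_eq -/M3.
    have H3 : M3 (tmp d) = cell (eval e s) by rewrite /M3 update_eq.
    have H4 : M3 (cell (eval e s)) = hp s (eval e s).
      rewrite /M3 /M2 !update_neq; try addr.
      by rewrite K1 ?R.2 // /scratch; addr.
    apply: go_load; first exact: C4.
      by rewrite /= H3 H4; apply: cost3.
    rewrite /= H3 H4.
    have -> : (p + size (cexpr d e)).+4 = p + (size (cexpr d e) + 4) by lia.
    exact: go0.
  + exact: update_eq.
  + by move=> a Ha; rewrite /M3 /M2 !update_neq ?K1 //; move: Ha; rewrite /scratch; addr.
- exact: (bin _ _ _ _ _ _ _ ADD addn go_add IH1 IH2).
- exact: (bin _ _ _ _ _ _ _ SUB subn go_sub IH1 IH2).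
- exact: (bin _ _ _ _ _ _ _ MULT muln go_mult IH1 IH2).
Qed.
End Expr.

(** * Weakest preconditions and correctness of compiled commands *)

Section Commands.

Variables (W Z : nat).

(* [W] bounds every stored value, and [Z] the number of rounds of every loop. *)
Definition bounded s := (forall x, sc s x <= W) /\ (forall h, hp s h <= W).

(** [B] is the predicate transformer of the body; abstracting over it keeps [wp] structurally
    recursive. There are [k] rounds left and the counter is at [i]. *)
Fixpoint loop (B : (state -> Prop) -> state -> Prop) x (Q : state -> Prop) k i s :=
  if k is k'.+1 then B (loop B x Q k' i.+1) (setv s x i) else Q (setv s x i).

(** Only stored values and loop limits carry bounds. Values of tests, addresses and written outputs
    carry none, since [esize] controls them. *)
Fixpoint wp c (Q : state -> Prop) s : Prop :=
  match c with
  | Skip => Q s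
  | Assign x e => eval e s <= W /\ Q (setv s x (eval e s))
  | Put e1 e2 => eval e2 s <= W /\ Q (seth s (eval e1 s) (eval e2 s))
  | Read x => head 0 (inp s) <= W /\
      Q (State (update (sc s) x (head 0 (inp s))) (hp s) (behead (inp s)) (out s))
  | Write e => Q (State (sc s) (hp s) (inp s) (rcons (out s) (eval e s)))
  | Seq c1 c2 => wp c1 (wp c2 Q) s
  | If e c1 c2 => if eval e s == 0 then wp c2 Q s else wp c1 Q s
  | For x e b =>
      [/\ eval e s <= W, eval e s <= Z & loop (wp b) x Q (eval e s) 0 s]
  end.

(* Chosen so that values stay below [W ^ esize e], including the factor 4 and
   the offset in heap addresses. *)
Fixpoint esize e :=
  match e with
  | Lit _ | Var _ => 1
  | Get e => (esize e).+1
  | Plus e1 e2 | Minus e1 e2 | Times e1 e2 => esize e1 + esize e2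
  end.

(** The constant 64 caps literals and register numbers of the program text; [64 <= W] then absorbs
    them. *)
Fixpoint small_expr d e :=
  match e with
  | Lit n => n <= 64
  | Var x => var x <= 64
  | Get e => small_expr d e && (tmp d <= 64)
  | Plus e1 e2 | Minus e1 e2 | Times e1 e2 =>
      [&& small_expr d e2, small_expr d.+1 e1 & tmp d <= 64]
  end.

Variable S : nat.

Fixpoint written c : seq nat :=
  match c with
  | Assign x _ | Read x => [:: x]
  | Seq c1 c2 | If _ c1 c2 => written c1 ++ written c2
  | For x _ b => x :: written b
  | _ => [::]
  end.

(** In [Put] the address needs [esize e1 < S], one power being spent on passing from [a] to
    [cell a]. The condition [x \notin written b] protects both the counter and the limit register,
    which an inner loop on [x] would overwrite. *)
Fixpoint small c :=
  match c with
  | Skip => true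
  | Assign x e => [&& small_expr 0 e, esize e <= S & lim x <= 64]
  | Put e1 e2 => [&& small_expr 0 e2, small_expr 1 e1, esize e1 < S & esize e2 <= S]
  | Read x => lim x <= 64
  | Write e => small_expr 0 e && (esize e <= S)
  | Seq c1 c2 => small c1 && small c2
  | If e c1 c2 => [&& small_expr 0 e, esize e <= S, small c1 & small c2]
  | For x e b => [&& small_expr 0 e, esize e <= S, lim x <= 64, x \notin written b & small b]
  end.

(** A state-independent bound in units of [8 * S + 8] instructions: both branches of a test are
    charged, and every loop is charged [Z] rounds. *)
Fixpoint csteps c :=
  match c with
  | Seq c1 c2 => csteps c1 + csteps c2
  | If _ c1 c2 => (csteps c1 + csteps c2).+1
  | For _ _ b => (Z * (csteps b).+1).+2
  | _ => 1
  end.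

Hypothesis W64 : 64 <= W.
Hypothesis S2 : 2 <= S.

Lemma esize_gt0 e : 0 < esize e.
Proof. by elim: e => //= e1 H1 e2 H2; lia. Qed.

Lemma leq_WX k : 0 < k -> W <= W ^ k.
Proof. by move=> k0; rewrite -{1}(expn1 W) leq_exp2l //; lia. Qed.

Lemma addn_WX a b : 0 < a -> 0 < b -> W ^ a + W ^ b <= W ^ (a + b).
Proof.
move=> a0 b0; have := leq_WX a0; have := leq_WX b0; rewrite expnD.
by move: (W ^ a) (W ^ b) => x y; nia.
Qed.

Lemma cell_WX a k : 0 < k -> a <= W ^ k -> cell a <= W ^ k.+1.
Proof. by move=> /leq_WX; rewrite expnS /cell; move: (W ^ k) => y; nia. Qed.

Lemma eval_bound s e d : bounded s -> small_expr d e -> eval e s <= W ^ esize e.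
Proof.
move=> [bs bh]; elim: e d => [n|x|e IH|e1 IH1 e2 IH2|e1 IH1 e2 IH2|e1 IH1 e2 IH2] d /=.
- by rewrite expn1; lia.
- by rewrite expn1.
- by move=> _; apply: leq_trans (bh _) _; apply: leq_WX.
- move=> /and3P[/IH2 l2 /IH1 l1 _].
  by apply: leq_trans (addn_WX (esize_gt0 _) (esize_gt0 _)); apply: leq_add.
- move=> /and3P[/IH2 l2 /IH1 l1 _].
  apply: leq_trans (leq_subr _ _) _; apply: leq_trans l1 _.
  by rewrite leq_exp2l ?leq_addr //; lia.
- by move=> /and3P[/IH2 l2 /IH1 l1 _]; rewrite expnD; apply: leq_mul.
Qed.

Lemma small_ebnd s e d k :
  bounded s -> small_expr d e -> esize e <= k -> ebnd (W ^ k) d e s.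
Proof.
move=> bs.
have Wk j : 0 < j -> j <= k -> W ^ j <= W ^ k by move=> _ H; rewrite leq_exp2l //; lia.
elim: e d => [n|x|e IH|e1 IH1 e2 IH2|e1 IH1 e2 IH2|e1 IH1 e2 IH2] d sm szk.
- by have := Wk 1 isT szk; move: sm => /=; rewrite expn1; lia.
- by have := Wk 1 isT szk; have := bs.1 x; move: sm => /=; rewrite expn1; lia.
- have := Wk 1 isT (leq_trans (esize_gt0 _) szk); rewrite expn1 => lW.
  move: (sm) (szk) => /= /andP[sm' st] sz'; rewrite IH //=; last by lia.
  have ev := eval_bound bs sm'.
  have := cell_WX (esize_gt0 e) ev; have := Wk _ (ltn0Sn _) sz'.
  by have := bs.2 (eval e s); lia.
- have := Wk 1 isT (leq_trans (esize_gt0 _) szk); rewrite expn1 => lW.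
  have := eval_bound bs sm; have := Wk _ (esize_gt0 _) szk.
  move: sm szk => /= /and3P[sm2 sm1 st] szk; rewrite IH1 ?IH2 //; lia.
- have := Wk 1 isT (leq_trans (esize_gt0 _) szk); rewrite expn1 => lW.
  have := eval_bound bs sm; have := Wk _ (esize_gt0 _) szk.
  move: sm szk => /= /and3P[sm2 sm1 st] szk; rewrite IH1 ?IH2 //; lia.
- have := Wk 1 isT (leq_trans (esize_gt0 _) szk); rewrite expn1 => lW.
  have := eval_bound bs sm; have := Wk _ (esize_gt0 _) szk.
  move: sm szk => /= /and3P[sm2 sm1 st] szk; rewrite IH1 ?IH2 //; lia.
Qed.

(** The surplus 2 makes the induction close: the two operands supply 4, which pays for the [STORE]
    and the operation of a binary node and leaves the surplus of the result. *)
Lemma size_cexpr d e : size (cexpr d e) + 2 <= 4 * esize e.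
Proof.
elim: e d => [n|x|e IH|e1 IH1 e2 IH2|e1 IH1 e2 IH2|e1 IH1 e2 IH2] d //=;
  rewrite ?size_cat /= ?size_cat /=; first by have := IH d; lia.
all: by have := IH1 d.+1; have := IH2 d; lia.
Qed.

Variable P : program.
Let V := W ^ S.
Let L := 4 * bitlen V.
(** A command has at most two expressions of its own, each of fewer than [4 * S] instructions,
    besides a few fixed instructions. *)
Let K := 8 * S + 8.

Let leqWV : W <= V. Proof. by apply: leq_WX; lia. Qed.
Let V4 : 4 <= V. Proof. lia. Qed.

Lemma bounded_setv s x a : bounded s -> a <= W -> bounded (setv s x a).
Proof. by move=> [b1 b2] la; split=> //= y; rewrite /update; case: ifP. Qed.

Lemma bounded_seth s x a : bounded s -> a <= W -> bounded (seth s x a).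
Proof. by move=> [b1 b2] la; split=> //= y; rewrite /update; case: ifP. Qed.

Lemma rel_ext s M M' : rel s M -> (forall a, ~~ scratch 0 a -> M' a = M a) -> rel s M'.
Proof. by move=> [r1 r2] E; split=> y; rewrite E ?r1 ?r2 // /scratch; addr. Qed.

Lemma rel_setv s M x a : rel s M -> rel (setv s x a) (update M (var x) a).
Proof.
move=> [r1 r2]; split=> y /=; last by rewrite update_neq ?r2 //; addr.
rewrite /update; have -> : (var y == var x) = (y == x) by apply/eqP/eqP; addr.
by rewrite r1.
Qed.

Lemma rel_seth s M x a : rel s M -> rel (seth s x a) (update M (cell x) a).
Proof.
move=> [r1 r2]; split=> y /=; first by rewrite update_neq ?r1 //; addr.
rewrite /update; have -> : (cell y == cell x) = (y == x) by apply/eqP/eqP; addr.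
by rewrite r2.
Qed.

Lemma rel_update s M a x :
  rel s M -> (forall y, a <> var y) -> (forall y, a <> cell y) -> rel s (update M a x).
Proof. by move=> [r1 r2] nv nc; split=> y; rewrite update_neq ?r1 ?r2 //; apply/nesym. Qed.

(** The last two clauses serve enclosing loops: their limit registers, which [rel] ignores, and
    their counters must survive the body. *)
Definition simulates c := forall Q p s M,
  small c -> code_at P p (compile p c) -> bounded s -> rel s M -> wp c Q s ->
  exists k s' M',
    [/\ go P L k (Config p M (inp s) (out s))
          (Config (p + size (compile p c)) M' (inp s') (out s')),
        k <= K * csteps c,
        [/\ rel s' M', bounded s' & Q s'],
        forall x, x \notin written c -> M' (lim x) = M (lim x)
      & forall x, x \notin written c -> sc s' x = sc s x].

Lemma simulates_for x e b : simulates b -> simulates (For x e b).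
Proof.
move=> IHb Q p s M sm C bs R; move: sm (C) => /and5P[sme sze smx nw smb].
move=> /code_at_cat[Ce []] Cst [Cl0] [Csx []] Cll [Csub [Cjz]] /code_at_cat[Cb] [Clx [Cad [Cst2 [Cj _]]]].
set top := (p + size (cexpr 0 e)).+3 in Cst Cl0 Csx Cll Csub Cjz Cb Clx Cad Cst2 Cj *.
set kb := compile top.+3 b in Cst Cl0 Csx Cll Csub Cjz Cb Clx Cad Cst2 Cj *.
move=> [evW evZ].
have [M1 [G1 E1 K1]] := go_expr V4 (inp s) (out s) Ce R (small_ebnd bs sme sze).
set n := eval e s in evW evZ E1 *.
have limV : lim x <= V by apply: leq_trans smx _; lia.
have varV : var x <= V by move: limV; rewrite /lim /var; lia.
pose M2 := update (update (update M1 (lim x) n) 0 0) (var x) 0.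
have R2 : rel (setv s x 0) M2.
  apply: rel_setv; apply: rel_update; try addr.
  apply: rel_update; try addr.
  exact: rel_ext R K1.
have pre : forall k t, go P L k (Config top M2 (inp s) (out s)) t ->
  go P L (size (cexpr 0 e) + k.+3) (Config p M (inp s) (out s)) t.
  move=> k t G; apply: go_trans G1 _.
  apply: go_store; first exact: Cst.
    by rewrite /= E1; apply: cost2 => //; lia.
  rewrite /= E1; apply: go_load; first exact: Cl0.
    by apply: cost1; lia.
  apply: go_store; first exact: Csx.
    by rewrite /= update_eq; apply: cost2.
  by rewrite /= update_eq.
(* Induction on the number [j] of remaining rounds. A full round takes 3 instructions for the test
   and 4 to increment and jump back, hence 7 plus the body; the failing last test takes 3. *)
have main : forall j i s0 M0, i + j = n -> bounded s0 -> i <= W ->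
    rel (setv s0 x i) M0 -> M0 (lim x) = n ->
    loop (wp b) x Q j i s0 ->
    exists k s' M',
    [/\ go P L k (Config top M0 (inp s0) (out s0))
          (Config (top.+3 + size kb + 4) M' (inp s') (out s')),
        k <= 3 + j * (7 + K * csteps b),
        [/\ rel s' M', bounded s' & Q s'],
        forall y, y \notin x :: written b -> M' (lim y) = M0 (lim y)
      & forall y, y \notin x :: written b -> sc s' y = sc s0 y].
  elim=> [|j IH] i s0 M0 ij bs0 iW R0 lim0 lp.
    have in0 : i = n by lia.
    have M0x : M0 (var x) = i by rewrite R0.1 /= update_eq.
    exists 3, (setv s0 x i), (update (update M0 0 n) 0 0); split.
    - apply: go_load; first exact: Cll.
        by rewrite /= lim0; apply: cost2 => //; lia.
      rewrite /= lim0; apply: go_sub; first exact: Csub.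
        rewrite /= update_eq; apply: cost3' => //; try lia.
        by rewrite update_neq ?M0x; [lia|addr].
      rewrite /=; set d := _ - _.
      have d0 : d = 0 by rewrite /d update_eq update_neq ?M0x; [lia|addr].
      rewrite d0; apply: go_jzero; first exact: Cjz.
        by rewrite update_eq; apply: cost1.
      by rewrite update_eq /=; apply: go0.
    - lia.
    - split=> //; last exact: bounded_setv.
      by apply: rel_update; try addr; apply: rel_update; try addr.
    - by move=> y; rewrite inE negb_or => _; upd.
    - by move=> y; rewrite inE negb_or /= => /andP[/eqP ? _]; rewrite update_neq.
  have M0x : M0 (var x) = i by rewrite R0.1 /= update_eq.
  pose M3 := update (update M0 0 n) 0 (n - i).
  have R3 : rel (setv s0 x i) M3.
    by apply: rel_update; try addr; apply: rel_update; try addr.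
  have bs1 : bounded (setv s0 x i) by apply: bounded_setv.
  have [k1 [s1 [M4 [G4 k1le [R4 bs4 lp4] lim4 sc4]]]] := IHb _ _ _ _ smb Cb bs1 R3 lp.
  have sx : sc s1 x = i by rewrite sc4 // /= update_eq.
  pose M5 := update (update (update M4 0 i) 0 i.+1) (var x) i.+1.
  have R5 : rel (setv s1 x i.+1) M5.
    by apply: rel_setv; apply: rel_update; try addr; apply: rel_update; try addr.
  have lim5 y : y \notin written b -> M5 (lim y) = M0 (lim y).
    by move=> ny; rewrite /M5; upd; rewrite lim4 // /M3; upd.
  have ijn : i.+1 + j = n by lia.
  have iW' : i.+1 <= W by lia.
  have limn : M5 (lim x) = n by rewrite lim5.
  have [k2 [s' [M' [G6 k2le [R6 bs6 Q6] lim6 sc6]]]] := IH _ _ _ ijn bs4 iW' R5 limn lp4.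
  exists (3 + (k1 + (4 + k2))), s', M'; split=> //.
  - apply: go_load; first exact: Cll.
      by rewrite /= lim0; apply: cost2 => //; lia.
    rewrite /= lim0; apply: go_sub; first exact: Csub.
      rewrite /= update_eq; apply: cost3' => //; try lia.
      by rewrite update_neq ?M0x; [lia|addr].
    rewrite /= update_eq (@update_neq _ _ _ (var x)); last by addr.
    rewrite M0x; apply: go_jzero; first exact: Cjz.
      by rewrite update_eq; apply: cost1; lia.
    rewrite update_eq ifF; last by lia.
    apply: go_trans G4 _; rewrite !addSn add0n.
    apply: go_load; first exact: Clx.
      by rewrite /= R4.1 sx; apply: cost2 => //; lia.
    rewrite /= R4.1 sx; apply: go_add; first exact: Cad.
      by rewrite /= update_eq; apply: cost2 => //; lia.
    rewrite /= update_eq addn1; apply: go_store; first exact: Cst2.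
      by rewrite /= update_eq; apply: cost2 => //; lia.
    rewrite /= update_eq; apply: (go_jump V4); first exact: Cj.
    exact: G6.
  - rewrite mulSn; lia.
  - move=> y ny; rewrite lim6 // lim5 //.
    by move: ny; rewrite inE negb_or => /andP[].
  - move=> y ny; rewrite sc6 // sc4 /=.
      by move: ny; rewrite inE negb_or => /andP[/eqP ? _]; rewrite update_neq.
    by move: ny; rewrite inE negb_or => /andP[].
move=> lp.
have limn : M2 (lim x) = n by rewrite /M2; upd.
have [k [s' [M' [G kle [R' bs' Q'] lim' sc']]]] := main n 0 s M2 erefl bs (leq0n _) R2 limn lp.
exists (size (cexpr 0 e) + k.+3), s', M'; split=> //.
- have -> : p + size (compile p (For x e b)) = top.+3 + size kb + 4.
    by rewrite /= !size_cat /= !size_cat -/top -/kb /top /=; lia.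
  exact: pre.
- have := size_cexpr 0 e; move: sze kle evZ; rewrite /= /K.
  set sz := size _; set B := csteps b => h1 h2 h3 h4.
  have : n * (7 + (8 * S + 8) * B) <= Z * (7 + (8 * S + 8) * B) by rewrite leq_mul2r h3 orbT.
  by nia.
- move=> y ny; rewrite lim' // /M2; upd.
  move: ny; rewrite inE negb_or => /andP[/eqP ny _].
  by rewrite update_neq ?K1 // /scratch; addr.
Qed.

Lemma wp_mono c : forall (Q1 Q2 : state -> Prop) s,
  (forall s', Q1 s' -> Q2 s') -> wp c Q1 s -> wp c Q2 s.
Proof.
elim: c => [|x e|e1 e2|x|e|c1 IH1 c2 IH2|e c1 IH1 c2 IH2|x e b IH] Q1 Q2 s H //=.
- exact: H.
- by case=> ? /H.
- by case=> ? /H.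
- by case=> ? /H.
- exact: H.
- by apply: IH1 => s'; apply: IH2.
- by case: ifP => _; [apply: IH2|apply: IH1].
- case=> eW eZ lp; split=> //; move: lp; move: {eW eZ} (eval e s) 0 => j i; elim: j i s => [|k IHk] i s /=; first exact: H.
  by apply: IH => s'; apply: IHk.
Qed.

Lemma compile_correct c : simulates c.
Proof.
elim: c => [|x e|e1 e2|x|e|c1 IH1 c2 IH2|e c1 IH1 c2 IH2|x e b IHb]; last exact: simulates_for.
- move=> Q p s M _ _ bs R q; exists 0, s, M; split=> //.
  by rewrite addn0; apply: go0.
- move=> Q p s M /and3P[sme sze smx] /code_at_cat[Ce [Cs _]] bs R [ev q].
  have [M1 [G1 E1 K1]] := go_expr V4 (inp s) (out s) Ce R (small_ebnd bs sme sze).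
  exists (size (cexpr 0 e) + 1), (setv s x (eval e s)), (update M1 (var x) (eval e s)).
  split=> //=.
  + rewrite size_cat; apply: go_trans G1 _; apply: go_store; first exact: Cs.
      by rewrite /= E1; apply: cost2; move: smx; rewrite /lim /var; lia.
    by rewrite /= E1 addn1 addnS; apply: go0.
  + by have := size_cexpr 0 e; rewrite /K; nia.
  + split=> //; last exact: bounded_setv.
    by apply: rel_setv; apply: rel_ext R K1.
  + move=> y; rewrite inE => /eqP ny; upd.
    by rewrite K1 // /scratch; addr.
  + by move=> y; rewrite inE => /eqP ny; upd.
- move=> Q p s M /and4P[sm2 sm1 sz1 sz2] /code_at_cat[C2 [Cs]].
  move=> /code_at_cat[C1 [Cm [Ca [Cs1 [Cl [Cs2 _]]]]]] bs R [ev q].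
  have [M1 [G1 E1 K1]] := go_expr V4 (inp s) (out s) C2 R (small_ebnd bs sm2 sz2).
  pose M2 := update M1 (tmp 0) (eval e2 s).
  have R2 : rel s M2 by apply: rel_update; try addr; apply: rel_ext R K1.
  have [M3 [G3 E3 K3]] := go_expr V4 (inp s) (out s) C1 R2 (small_ebnd bs sm1 (ltnW sz1)).
  have ce : cell (eval e1 s) <= V.
    apply: leq_trans (cell_WX (esize_gt0 e1) (eval_bound bs sm1)) _.
    by rewrite leq_exp2l //; lia.
  have M3t : M3 (tmp 0) = eval e2 s by rewrite K3 /M2; [upd|rewrite /scratch; addr].
  pose M4 := update (update (update (update M3 0 (eval e1 s * 4)) 0 (cell (eval e1 s)))
               (tmp 1) (cell (eval e1 s))) 0 (eval e2 s).
  have R4 : rel s M4.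
    do 4!(apply: rel_update; try addr).
    case: R2 => r1 r2; split=> y; rewrite K3 ?r1 ?r2 // /scratch; addr.
  exists (size (cexpr 0 e2) + (size (cexpr 1 e1) + 5).+1), (seth s (eval e1 s) (eval e2 s)),
     (update M4 (cell (eval e1 s)) (eval e2 s)).
  split=> //=.
  + rewrite size_cat; apply: go_trans G1 _; apply: go_store; first exact: Cs.
      by rewrite /= E1; apply: cost2 => //; rewrite /tmp; lia.
    rewrite /= E1; apply: go_trans G3 _.
    have b4 : eval e1 s * 4 <= V by move: ce; rewrite /cell; lia.
    have c4 : eval e1 s * 4 + 4 = cell (eval e1 s) by rewrite /cell; lia.
    apply: go_mult; first exact: Cm.
      by rewrite /= E3; apply: cost2 => //; lia.
    rewrite /= E3; apply: go_add; first exact: Ca.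
      by rewrite /= update_eq; apply: cost2.
    rewrite /= update_eq c4; apply: go_store; first exact: Cs1.
      by rewrite /= update_eq; apply: cost2 => //; rewrite /tmp; lia.
    rewrite /= update_eq; apply: go_load; first exact: Cl.
      by rewrite /=; upd; rewrite M3t; apply: cost2; rewrite /tmp; lia.
    rewrite /= ; set v := (X in update _ _ X).
    have -> : v = eval e2 s by rewrite /v; upd.
    rewrite -/M4; have M40 : M4 0 = eval e2 s by rewrite /M4 update_eq.
    have M41 : M4 (tmp 1) = cell (eval e1 s) by rewrite /M4; upd.
    apply: go_store; first exact: Cs2.
      by rewrite /= M41 M40 addnA; apply: cost3 => //; rewrite /tmp; lia.
    rewrite /= M41 M40 size_cat /=.
    set a := (p + _).+1; set b := (a + _).+4; set z := p + _.
    have -> : z = b.+1 by rewrite /z /b /a; lia.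
    exact: go0.
  + by have := size_cexpr 0 e2; have := size_cexpr 1 e1; rewrite /K; nia.
  + by split=> //; [apply: rel_seth|apply: bounded_seth].
  + move=> y _; upd; rewrite /M4; upd.
    rewrite K3 /M2; last by rewrite /scratch; addr.
    by upd; rewrite K1 // /scratch; addr.
- move=> Q p s M smx [Cr _] bs R [hW q].
  exists 1, (State (update (sc s) x (head 0 (inp s))) (hp s) (behead (inp s)) (out s)),
    (update M (var x) (head 0 (inp s))); split=> //=.
  + apply: goS; last exact: go0.
      by rewrite /step /current /= Cr addn1.
    rewrite /step_cost /current /= Cr /=; apply: cost2 => //; first by lia.
    by have : lim x <= 64 := smx; have := leqWV; rewrite /lim /var; lia.
  + by rewrite /K; lia.
  + split=> //; first exact: (rel_setv x (head 0 (inp s)) R).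
    exact: (bounded_setv x bs hW).
  + by move=> y; rewrite inE => /eqP ny; upd.
  + by move=> y; rewrite inE => /eqP ny; upd.
- move=> Q p s M /andP[sme sze] /code_at_cat[Ce [Cw _]] bs R q.
  have [M1 [G1 E1 K1]] := go_expr V4 (inp s) (out s) Ce R (small_ebnd bs sme sze).
  exists (size (cexpr 0 e) + 1), (State (sc s) (hp s) (inp s) (rcons (out s) (eval e s))), M1.
  split=> //=.
  + rewrite size_cat; apply: go_trans G1 _; apply: goS; last exact: go0.
      by rewrite /step /current /= Cw addn1 addnS /= E1.
    rewrite /step_cost /current /= Cw /= E1; apply: cost2 => //.
    exact: ebnd_eval (small_ebnd bs sme sze).
  + by have := size_cexpr 0 e; rewrite /K; nia.
  + by split=> //; apply: (rel_ext R K1).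
  + by move=> y _; rewrite K1 // /scratch; addr.
- move=> Q p s M /andP[sm1 sm2] /code_at_cat[C1 C2] bs R w.
  have [k1 [s1 [M1 [G1 le1 [R1 bs1 w1] l1 x1]]]] := IH1 _ _ _ _ sm1 C1 bs R w.
  have [k2 [s2 [M2 [G2 le2 [R2 bs2 w2] l2 x2]]]] := IH2 _ _ _ _ sm2 C2 bs1 R1 w1.
  exists (k1 + k2), s2, M2; split=> //=.
  + by rewrite size_cat addnA; apply: go_trans G1 G2.
  + by rewrite mulnDr leq_add.
  + by move=> y; rewrite mem_cat negb_or => /andP[n1 n2]; rewrite l2 ?l1.
  + by move=> y; rewrite mem_cat negb_or => /andP[n1 n2]; rewrite x2 ?x1.
- move=> Q p s M /and4P[sme sze sm1 sm2] /=.
  set p1 := (p + size _).+1; set K1 := compile p1 c1; set p2 := (p1 + _).+1.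
  set K2 := compile p2 c2.
  move=> /code_at_cat[Ce [Cz]] /code_at_cat[C1 [Cj C2]] bs R w.
  have [M1 [G1 E1 H1]] := go_expr V4 (inp s) (out s) Ce R (small_ebnd bs sme sze).
  have ev : eval e s <= V by exact: ebnd_eval (small_ebnd bs sme sze).
  have endq : p + size (cexpr 0 e ++ JZERO p2 :: K1 ++ JUMP (p2 + size K2) :: K2) =
      p2 + size K2.
    by rewrite size_cat /= size_cat /= /p2 /p1; lia.
  rewrite endq; have R1 := rel_ext R H1; have szc := size_cexpr 0 e.
  move: w; case: ifPn => [/eqP e0|ne0] w.
  + have [k2 [s2 [M2 [G2 le2 [R2 bs2 w2] l2 x2]]]] := IH2 _ _ _ _ sm2 C2 bs R1 w.
    exists (size (cexpr 0 e) + k2.+1), s2, M2; split=> //.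
    * apply: go_trans G1 _; apply: go_jzero; first exact: Cz.
        by rewrite E1; apply: cost1.
      by rewrite E1 e0.
    * by move: le2; rewrite /K; nia.
    * move=> y; rewrite mem_cat negb_or => /andP[n1 n2]; rewrite l2 //.
      by rewrite H1 // /scratch; addr.
    * by move=> y; rewrite mem_cat negb_or => /andP[n1 n2]; rewrite x2.
  + have [k2 [s2 [M2 [G2 le2 [R2 bs2 w2] l2 x2]]]] := IH1 _ _ _ _ sm1 C1 bs R1 w.
    exists (size (cexpr 0 e) + (k2 + 1).+1), s2, M2; split=> //.
    * apply: go_trans G1 _; apply: go_jzero; first exact: Cz.
        by rewrite E1; apply: cost1.
      rewrite E1 (negbTE ne0); apply: go_trans G2 _.
      by apply: (go_jump V4); [exact: Cj|apply: go0].
    * by move: le2; rewrite /K; nia.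
    * move=> y; rewrite mem_cat negb_or => /andP[n1 n2]; rewrite l2 //.
      by rewrite H1 // /scratch; addr.
    * by move=> y; rewrite mem_cat negb_or => /andP[n1 n2]; rewrite x2.
Qed.

End Commands.

Definition start input := State (fun=> 0) (fun=> 0) input [::].

(** The bridge from the program logic to the machine: number of steps times the cost
    [4 * bitlen (W ^ S)] of a step, plus the final halt. *)
Lemma wp_computes S W Z c input (Q : seq nat -> Prop) :
  2 <= S -> 64 <= W -> small S c ->
  wp W Z c (fun s => Q (out s)) (start input) ->
  exists t o, [/\ computes_in (compile 0 c) input t o, Q o &
    t <= (8 * S + 8) * csteps Z c * (4 * bitlen (W ^ S)) + 1].
Proof.
move=> S2 W64 sm w.
have bs : bounded W (start input) by split.
have R : rel (start input) (fun=> 0) by split.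
have [k [s' [M' [G kle [_ _ Q'] _ _]]]] :=
  compile_correct W64 S2 sm (code_at_self _) bs R w.
have halt : current (compile 0 c)
  (Config (0 + size (compile 0 c)) M' (inp s') (out s')) = HALT.
  by rewrite /current nth_default.
have [t r tle] := go_runs G halt.
exists t, (out s'); split=> //.
by apply: leq_trans tle _; rewrite leq_add2r leq_mul2r kle orbT.
Qed.
(** * Program logic *)

Arguments wp : simpl never.

Fixpoint puts c := match c with
  | Put _ _ => true
  | Seq c1 c2 | If _ c1 c2 => puts c1 || puts c2
  | For _ _ b => puts b
  | _ => false end.

Fixpoint reads c := match c with
  | Read _ => true
  | Seq c1 c2 | If _ c1 c2 => reads c1 || reads c2
  | For _ _ b => reads b
  | _ => false end.

Fixpoint writes c := match c with
  | Write _ => true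
  | Seq c1 c2 | If _ c1 c2 => writes c1 || writes c2
  | For _ _ b => writes b
  | _ => false end.

Section Rules.
Variables (W Z : nat).
Local Notation wp := (wp W Z).
Local Notation bounded := (bounded W).

(* What a run of [c] leaves unchanged can be read off its text. *)
Record framed c s s' : Prop := Framed {
  fr_bounded : bounded s';
  fr_sc : forall x, x \notin written c -> sc s' x = sc s x;
  fr_hp : ~~ puts c -> hp s' = hp s;
  fr_inp : ~~ reads c -> inp s' = inp s;
  fr_out : ~~ writes c -> out s' = out s }.

Lemma wp_assign x e Q s :
  eval e s <= W -> Q (setv s x (eval e s)) -> wp (Assign x e) Q s.
Proof. by []. Qed.

Lemma wp_put e1 e2 Q s :
  eval e2 s <= W -> Q (seth s (eval e1 s) (eval e2 s)) -> wp (Put e1 e2) Q s.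
Proof. by []. Qed.

Lemma wp_write e Q s :
  Q (State (sc s) (hp s) (inp s) (rcons (out s) (eval e s))) -> wp (Write e) Q s.
Proof. by []. Qed.

Lemma wp_if e c1 c2 Q s :
  (0 < eval e s -> wp c1 Q s) -> (eval e s = 0 -> wp c2 Q s) -> wp (If e c1 c2) Q s.
Proof. by rewrite /wp /= -/(wp c1 Q s) -/(wp c2 Q s) => H1 H2; case: posnP. Qed.

Lemma framed_setv x e b s i : bounded s -> i <= W -> framed (For x e b) s (setv s x i).
Proof.
move=> bs iW; split=> //; first exact: bounded_setv.
by move=> y; rewrite inE negb_or /= => /andP[/eqP ny _]; rewrite update_neq.
Qed.

Lemma framed_trans c s1 s2 s3 : framed c s1 s2 -> framed c s2 s3 -> framed c s1 s3.
Proof.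
case=> b1 v1 h1 i1 o1 [b2 v2 h2 i2 o2]; split=> //.
- by move=> x nx; rewrite v2 ?v1.
- by move=> H; rewrite h2 ?h1.
- by move=> H; rewrite i2 ?i1.
- by move=> H; rewrite o2 ?o1.
Qed.

Lemma framed_incl c c' s s' :
  {subset written c <= written c'} -> (puts c -> puts c') -> (reads c -> reads c') ->
  (writes c -> writes c') -> framed c s s' -> framed c' s s'.
Proof.
move=> wr pu re wi [b v h i o]; split=> // [x nx|||].
- by apply: v; apply: contra nx; apply: wr.
- by move=> H; apply: h; apply: contra H.
- by move=> H; apply: i; apply: contra H.
- by move=> H; apply: o; apply: contra H.
Qed.

Lemma framed_for x e b s s' : framed b s s' -> framed (For x e b) s s'.
Proof. by apply: framed_incl => // y yb; rewrite inE yb orbT. Qed.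

Lemma framed_seq c1 c2 s s1 s' :
  framed c1 s s1 -> framed c2 s1 s' -> framed (Seq c1 c2) s s'.
Proof.
move=> f1 f2; apply: (@framed_trans _ _ s1).
  by apply: framed_incl f1 => [y yb|H|H|H] /=; rewrite ?mem_cat ?yb ?H.
by apply: framed_incl f2 => [y yb|H|H|H] /=; rewrite ?mem_cat ?yb ?H ?orbT.
Qed.

(** The frame property of the body is assumed because [wp_frame] applies this rule inside its own
    induction; [wp_for] later discharges the assumption. *)
Lemma wp_loop x e b (Inv : nat -> state -> Prop) Q s n :
  (forall Q s, bounded s -> wp b Q s -> wp b (fun s' => Q s' /\ framed b s s') s) ->
  bounded s -> n <= W ->
  (forall i s', i < n -> framed (For x e b) s s' -> Inv i s' -> wp b (Inv i.+1) (setv s' x i)) ->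
  (forall s', framed (For x e b) s s' -> Inv n s' -> Q (setv s' x n)) ->
  forall j i s', i + j = n -> framed (For x e b) s s' -> Inv i s' -> loop (wp b) x Q j i s'.
Proof.
move=> fr bs nW body fin; elim=> [|j IH] i s' ij fs' inv /=.
  by have E : i = n; [lia | rewrite E in inv *; apply: fin].
have ijn : i < n by lia.
have iW : i <= W by lia.
have bs' : bounded (setv s' x i) by apply: bounded_setv iW; exact: fr_bounded fs'.
apply: wp_mono (fr _ _ bs' (body _ _ ijn fs' inv)) => s'' [inv' fr'].
apply: IH => //; first by lia.
apply: framed_trans (fs') _; apply: (@framed_trans _ _ (setv s' x i)); last exact: framed_for.
by apply: framed_setv iW; exact: fr_bounded fs'.
Qed.

Lemma wp_frame c : forall Q s,
  bounded s -> wp c Q s -> wp c (fun s' => Q s' /\ framed c s s') s.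
Proof.
elim: c => [|x e|e1 e2|x|e|c1 IH1 c2 IH2|e c1 IH1 c2 IH2|x e b IH] Q s bs.
- by split.
- case=> eW q; split=> //; split=> //; split=> //; first exact: bounded_setv.
  by move=> y; rewrite inE => /eqP ny /=; rewrite update_neq.
- case=> eW q; split=> //; split=> //; split=> //; exact: bounded_seth.
- case=> eW q; split=> //; split=> //; split=> //; first exact: (bounded_setv x bs eW).
  by move=> y; rewrite inE => /eqP ny /=; rewrite update_neq.
- by move=> q; split.
- move=> /(IH1 _ _ bs); apply: wp_mono => s1 [/IH2 H f1].
  have /H : bounded s1 by case: f1.
  by apply: wp_mono => s' [q f2]; split=> //; apply: framed_seq f1 f2.
- move=> H; apply: wp_if => E; move: H; rewrite /wp /=.
  + rewrite gtn_eqF // => /(IH1 _ _ bs); apply: wp_mono => s' [q f]; split=> //.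
    by apply: framed_incl f => [y yb|h|h|h] /=; rewrite ?mem_cat ?yb ?h.
  + rewrite E eqxx => /(IH2 _ _ bs); apply: wp_mono => s' [q f]; split=> //.
    by apply: framed_incl f => [y yb|h|h|h] /=; rewrite ?mem_cat ?yb ?h ?orbT.
- case=> eW eZ lp; split=> //.
  (* The precondition of the remaining rounds is itself an invariant, so only the frame has to be
     threaded through the loop. *)
  pose Inv i s' := loop (wp b) x Q (eval e s - i) i s'.
  apply: (@wp_loop x e b Inv _ s (eval e s)) => //; last 1 first.
  + by rewrite /Inv subn0.
  + move=> i s' ltin fs'; rewrite /Inv subnS.
    by case: (eval e s - i) (subn_gt0 i (eval e s)) => [|k _]; first by rewrite ltin.
  + move=> s' fs'; rewrite /Inv subnn /= => q; split=> //.
    by apply: framed_trans (fs') _; apply: framed_setv (fr_bounded fs') eW.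
Qed.

Lemma wp_seq c1 c2 Q s : wp c1 (wp c2 Q) s -> wp (Seq c1 c2) Q s.
Proof. by []. Qed.

(** Consequence rule that adds the frame of [c] for free, so a specification [R] need only mention
    what [c] changes. *)
Lemma wp_cut c R Q s :
  bounded s -> wp c R s -> (forall s', framed c s s' -> R s' -> Q s') -> wp c Q s.
Proof. by move=> bs /(wp_frame bs) H HQ; apply: wp_mono H => s' [r f]; apply: HQ. Qed.

(** [Inv i] is asserted just before the counter is set to [i], so the invariants used below do not
    speak of the counter. *)
Lemma wp_for x e b (Inv : nat -> state -> Prop) Q s :
  bounded s -> eval e s <= W -> eval e s <= Z -> Inv 0 s ->
  (forall i s', i < eval e s -> framed (For x e b) s s' -> bounded (setv s' x i) ->
     Inv i s' -> wp b (Inv i.+1) (setv s' x i)) ->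
  (forall s', framed (For x e b) s s' -> Inv (eval e s) s' -> Q (setv s' x (eval e s))) ->
  wp (For x e b) Q s.
Proof.
move=> bs eW eZ inv0 body fin; split=> //.
apply: (@wp_loop x e b Inv _ s (eval e s)) => //; first exact: wp_frame.
move=> i s' ltin fs' inv; apply: body => //.
by apply: bounded_setv; [case: fs'|lia].
Qed.

End Rules.

Declare Scope cmd_scope.
Delimit Scope cmd_scope with cmd.
Bind Scope cmd_scope with cmd.
Notation "c1 ;; c2" := (Seq c1 c2) (at level 60, right associativity) : cmd_scope.
Local Open Scope cmd_scope.

(** * The search program *)

(* Heap layout: cell [2 * t] holds the assignment of TA [t] under the current
   candidate (0 if unassigned, [x.+1] for course [x]), and cell [2 * i + 1] holds
   the [i]-th input item after the two dimensions. *)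
Notation xn := 0 (only parsing).
Notation xm := 1 (only parsing).
Notation xcount := 2 (only parsing).
Notation xi := 3 (only parsing).
Notation xq := 4 (only parsing).
Notation xt := 5 (only parsing).
Notation xquo := 6 (only parsing).
Notation xrem := 7 (only parsing).
Notation xj := 8 (only parsing).
Notation xok := 9 (only parsing).
Notation xx := 10 (only parsing).
Notation xnum := 11 (only parsing).
Notation xsum := 12 (only parsing).
Notation xt2 := 13 (only parsing).
Notation xbest := 14 (only parsing).

(* Division of [xq] by [xn + 1] by repeated subtraction; [xq] rounds suffice. *)
Definition divide : cmd :=
  For xj (Var xq)
    (If (Minus (Var xrem) (Var xn))
       (Assign xrem (Minus (Var xrem) (Plus (Var xn) (Lit 1))) ;;
        Assign xquo (Plus (Var xquo) (Lit 1)))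
       Skip).

Definition decode : cmd :=
  Assign xq (Var xi) ;;
  For xt (Var xm)
    (Assign xquo (Lit 0) ;; Assign xrem (Var xq) ;; divide ;;
     Put (Times (Lit 2) (Var xt)) (Var xrem) ;; Assign xq (Var xquo)).

Definition digit n i t := (i %/ n.+1 ^ t) %% n.+1.

(** * Decoding a candidate number and testing the candidate *)

Section Specs.
Variables (W Z : nat).
Hypothesis W64 : 64 <= W.
Local Notation wp := (wp W Z).
Local Notation bounded := (bounded W).

Lemma wp_divide s q :
  bounded s -> sc s xq = q -> sc s xrem = q -> sc s xquo = 0 -> q <= Z ->
  wp divide (fun s' => sc s' xquo = q %/ (sc s xn).+1 /\ sc s' xrem = q %% (sc s xn).+1) s.
Proof.
move=> bs sq sr squo qZ; set n := sc s xn.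
(* Either the division is over or every round so far has subtracted. After [q] rounds the second
   case gives [q = q * n.+1 + xrem], which forces [xrem = 0]. *)
pose Inv j s' := q = sc s' xquo * n.+1 + sc s' xrem /\ (sc s' xrem <= n \/ sc s' xquo = j).
apply: (@wp_for _ _ _ _ _ Inv) => //=.
- exact: bs.1.
- by rewrite sq.
- by rewrite /Inv squo sr; split; [lia|right].
- rewrite sq => j s' ltjq fs' bs' [I1 I2].
  have nE : sc s' xn = n by rewrite (fr_sc fs').
  apply: wp_if => /=; rewrite /update /= nE => E; last first.
    by split=> /=; rewrite /update /=; [|left; lia].
  have qjq : q <= W by rewrite -sq; apply: bs.1.
  apply: wp_seq; apply: wp_assign => /=; rewrite /update /= nE; first by lia.
  apply: wp_assign => /=; rewrite /update /=; first by nia.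
  rewrite /Inv /= /update /=; split; first by lia.
  right; lia.
- rewrite sq => s' fs' [I1 I2]; rewrite /update /=.
  have ltr : sc s' xrem < n.+1.
    by case: I2 => // I2; move: I1; rewrite I2; nia.
  by rewrite I1 divnMDl // modnMDl divn_small // modn_small // addn0.
Qed.

(** The bound on [xi] is there because each division takes as many rounds as its dividend, a
    quotient of [xi]. Items sit in odd cells and are untouched. *)
Lemma wp_decode s :
  bounded s -> sc s xm <= Z -> sc s xi <= Z ->
  wp decode (fun s' =>
    (forall t, t < sc s xm -> hp s' (2 * t) = digit (sc s xn) (sc s xi) t) /\
    (forall i, hp s' (2 * i + 1) = hp s (2 * i + 1))) s.
Proof.
move=> bs mZ iZ; apply: wp_seq; apply: wp_assign => /=; first exact: bs.1.
set n := sc s xn; set m := sc s xm in mZ *; set i := sc s xi in iZ *; set s0 := setv _ _ _.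
have bs0 : bounded s0 by apply: bounded_setv => //; exact: bs.1.
pose Inv t s' := [/\ sc s' xq = i %/ n.+1 ^ t,
   forall t', t' < t -> hp s' (2 * t') = digit n i t' &
   forall j, hp s' (2 * j + 1) = hp s (2 * j + 1)].
apply: (@wp_for _ _ _ _ _ Inv) => //=; rewrite /update /= -/m.
- exact: bs.1.
- by split=> //=; rewrite /update /= divn1.
- move=> t s' ltm fs' bs' [I1 I2 I3].
  have nE : sc s' xn = n by rewrite (fr_sc fs').
  have bd := fr_bounded fs'.
  have qi : i %/ n.+1 ^ t <= i by apply: leq_div.
  apply: wp_seq; apply: wp_assign => //=.
  apply: wp_seq; apply: wp_assign; rewrite /= /update /=; first exact: bd.1.
  set s1 := setv _ _ _; have bs1 : bounded s1.
    by apply: bounded_setv; [apply: bounded_setv|exact: bd.1].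
  apply: wp_seq; apply: (wp_cut bs1).
    by apply: (@wp_divide s1 (sc s' xq) bs1) => //; rewrite I1; lia.
  have -> : sc s1 xn = n by rewrite -nE.
  move=> s2 fs2 [quo2 rem2]; have bs2 := fr_bounded fs2.
  have t2 : sc s2 xt = t by rewrite (fr_sc fs2).
  apply: wp_seq; apply: wp_put => /=; first exact: bs2.1.
  apply: wp_assign => /=; first exact: bs2.1.
  rewrite t2 rem2 quo2 I1 -divnMA -expnSr; split=> //=.
  + move=> t' lt'; rewrite /update; case: eqP => [e|ne].
      by have -> : t' = t by lia.
    by rewrite (fr_hp fs2) //= I2 //; lia.
  + by move=> j; rewrite update_neq ?(fr_hp fs2) //=; lia.
- by move=> s' fs' [_ I2 I3]; split.
Qed.

(** The largest index comes last, as in a loop that accumulates a verdict, so an invariant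
    [ok && all_below p k] unfolds once per round. *)
Fixpoint all_below (p : nat -> bool) k := if k is k'.+1 then all_below p k' && p k' else true.

Lemma all_belowP (p : nat -> bool) k : reflect (forall i, i < k -> p i) (all_below p k).
Proof.
elim: k => [|k IH] /=; first by left.
apply: (iffP andP) => [[/IH H pk] i|H].
  by rewrite ltnS leq_eqVlt => /predU1P[->|/H].
by split; [apply/IH => i ik; apply: H; apply: ltnW|apply: H].
Qed.

Section Check.
Variables (h : nat -> nat) (n m : nat).

(* The instance and the candidate as laid out in the heap [h]. *)
Definition hmu t := h (2 * t).
Definition hitem i := h (2 * i + 1).
(** The offsets below follow the encoding: [n * m] utilities, [2 * (n * m)] entries for grades, [n]
    capacities, [n * m] course utilities, then [k]. For rationals, [b = 0] selects the numerator and
    [b = 1] the denominator. *)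
Definition hu t x := hitem (t * n + x).
Definition hg t x b := hitem (n * m + (2 * (t * n + x) + b)).
Definition hcap x := hitem (3 * (n * m) + x).
Definition hv x t := hitem (3 * (n * m) + (n + (x * m + t))).
Definition hk b := hitem (4 * (n * m) + (n + b)).

Definition tally x k := \sum_(t < k) (hmu t == x.+1).
Definition total x k := \sum_(t < k) (hmu t == x.+1) * hv x t.

Definition acceptable x t := (hmu t == x.+1) ==> (0 < hu t x).

Definition course_ok x :=
  [&& all_below (acceptable x) m, tally x m == hcap x
    & hcap x * hk 0 <= hk 1 * total x m].

Definition hutil t := if hmu t is x.+1 then hu t x else 0.

(** The first disjunct is [g ti x < g tj x] cleared of denominators: either [ti] lacks the merit for
    the course [x] of [tj], or [ti] does not prefer it. *)
Definition envy_free ti tj :=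
  if hmu tj is x.+1 then
    (hg ti x 0 * hg tj x 1 < hg tj x 0 * hg ti x 1) || (hu ti x <= hutil ti)
  else true.

Definition valid :=
  all_below course_ok n && all_below (fun ti => all_below (envy_free ti) m) m.

End Check.

Definition item e := Get (Plus (Times (Lit 2) e) (Lit 1)).
Definition emu t := Get (Times (Lit 2) t).
Definition eu t x := item (Plus (Times t (Var xn)) x).
Definition eg t x b :=
  item (Plus (Times (Var xn) (Var xm)) (Plus (Times (Lit 2) (Plus (Times t (Var xn)) x)) (Lit b))).
Definition ecap x := item (Plus (Times (Lit 3) (Times (Var xn) (Var xm))) x).
Definition ev x t :=
  item (Plus (Times (Lit 3) (Times (Var xn) (Var xm)))
         (Plus (Var xn) (Plus (Times x (Var xm)) t))).
Definition ek b :=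
  item (Plus (Times (Lit 4) (Times (Var xn) (Var xm))) (Plus (Var xn) (Lit b))).
(** Subtraction is cut off at 0, so this is the absolute difference, positive exactly when the
    values differ. *)
Definition differ a b := Plus (Minus a b) (Minus b a).
Definition reject : cmd := Assign xok (Lit 0).

Definition scan : cmd :=
  For xt (Var xm)
    (If (differ (emu (Var xt)) (Plus (Var xx) (Lit 1))) Skip
       (Assign xnum (Plus (Var xnum) (Lit 1)) ;;
        Assign xsum (Plus (Var xsum) (ev (Var xx) (Var xt))) ;;
        If (eu (Var xt) (Var xx)) Skip reject)).

Definition check_courses : cmd :=
  For xx (Var xn)
    (Assign xnum (Lit 0) ;; Assign xsum (Lit 0) ;; scan ;;
     If (differ (Var xnum) (ecap (Var xx))) reject Skip ;;
     If (Minus (Times (ecap (Var xx)) (ek 0)) (Times (ek 1) (Var xsum))) reject Skip).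

(** [xnum] is reused for the present utility of [xt], with 0 for an unassigned TA. *)
Definition check_pair : cmd :=
  If (emu (Var xt2))
    (Assign xx (Minus (emu (Var xt2)) (Lit 1)) ;;
     Assign xnum (Lit 0) ;;
     If (emu (Var xt))
       (Assign xnum (eu (Var xt) (Minus (emu (Var xt)) (Lit 1)))) Skip ;;
     If (Minus (Times (eg (Var xt2) (Var xx) 0) (eg (Var xt) (Var xx) 1))
               (Times (eg (Var xt) (Var xx) 0) (eg (Var xt2) (Var xx) 1))) Skip
       (If (Minus (eu (Var xt) (Var xx)) (Var xnum)) reject Skip))
    Skip.

Definition check_envy : cmd := For xt (Var xm) (For xt2 (Var xm) check_pair).

Definition check : cmd := Assign xok (Lit 1) ;; check_courses ;; check_envy.

Record holds h n m s : Prop := Holds {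
  ho_bounded : bounded s; ho_hp : hp s = h; ho_n : sc s xn = n; ho_m : sc s xm = m }.

Lemma holds_setv h n m s x a :
  holds h n m s -> 1 < x -> a <= W -> holds h n m (setv s x a).
Proof.
case=> b1 b2 b3 b4 x1 aW; split=> //=; first exact: bounded_setv.
  by rewrite update_neq ?b3 //; lia.
by rewrite update_neq ?b4 //; lia.
Qed.

Lemma holds_framed h n m c s s' :
  holds h n m s -> framed W c s s' -> ~~ puts c -> xn \notin written c -> xm \notin written c ->
  holds h n m s'.
Proof.
case=> b1 b2 b3 b4 [f1 f2 f3 _ _] np nn nm; split=> //.
- by rewrite f3.
- by rewrite f2.
- by rewrite f2.
Qed.

Variables (h : nat -> nat) (n m B : nat).
Hypothesis mZ : m <= Z.
Hypothesis nZ : n <= Z.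
Hypothesis hB : forall i, hitem h i <= B.
Hypothesis mBW : m * B <= W.
Local Notation ready := (holds h n m).

Lemma tally_leq x j : tally h x j <= j.
Proof.
rewrite -[j in _ <= j]card_ord -sum1_card; apply: leq_sum => t _.
exact: leq_b1.
Qed.

(** The cross products are evaluated but never stored, whereas this running sum is; hence the
    hypothesis [m * B <= W]. *)
Lemma total_leq x j : total h n m x j <= j * B.
Proof.
rewrite -[j in _ <= j * B]card_ord -sum_nat_const; apply: leq_sum => t _.
by rewrite -[B]mul1n leq_mul ?leq_b1 ?hB.
Qed.

Lemma ready_leq s : ready s -> m <= W /\ n <= W.
Proof. by move=> hs; rewrite -(ho_m hs) -(ho_n hs) !(ho_bounded hs).1. Qed.

Lemma wp_scan s x (ok : bool) :
  ready s -> sc s xx = x -> sc s xnum = 0 -> sc s xsum = 0 -> sc s xok = ok ->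
  wp scan (fun s' => [/\ sc s' xnum = tally h x m, sc s' xsum = total h n m x m
     & sc s' xok = ok && all_below (acceptable h n x) m]) s.
Proof.
move=> hs sx s0 t0 sok; have [mW nW] := ready_leq hs.
pose Inv k s' := [/\ sc s' xnum = tally h x k, sc s' xsum = total h n m x k
     & sc s' xok = ok && all_below (acceptable h n x) k].
apply: (@wp_for _ _ _ _ _ Inv) => /=.
- exact: ho_bounded hs.
- exact: (ho_bounded hs).1.
- by rewrite (ho_m hs).
- by split=> //=; rewrite /tally /total ?big_ord0 ?andbT.
- rewrite (ho_m hs) => k s' ltkm fs' _ [I1 I2 I3].
  have hs1 : ready (setv s' xt k) by apply: holds_setv; [apply: holds_framed fs' _ _ _| |lia].
  have x1 : sc (setv s' xt k) xx = x by rewrite /= /update /= (fr_sc fs').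
  have [t1 H1 H2 H3] : [/\ sc (setv s' xt k) xt = k, sc (setv s' xt k) xnum = tally h x k,
    sc (setv s' xt k) xsum = total h n m x k &
    sc (setv s' xt k) xok = ok && all_below (acceptable h n x) k] by [].
  (* The concrete state is forgotten in favour of the facts just recorded, which keeps later terms
     small; the same device recurs below. *)
  move: (setv s' xt k) hs1 x1 t1 H1 H2 H3 => s1 hs1 x1 t1 H1 H2 H3.
  have totW : total h n m x k.+1 <= W.
    by apply: leq_trans (total_leq _ _) _; apply: leq_trans mBW; rewrite leq_mul2r ltkm orbT.
  have talW : tally h x k.+1 <= W by apply: leq_trans (tally_leq _ _) _; lia.
  rewrite /Inv /= /acceptable; move: totW talW; rewrite /tally /total !big_ord_recr /=.
  rewrite -/(tally h x k) -/(total h n m x k) => totW talW.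
  apply: wp_if => /=; rewrite x1 t1 (ho_hp hs1) -/(hmu h k) => E.
    have -> : (hmu h k == x.+1) = false by lia.
    by split=> /=; rewrite ?H1 ?H2 ?H3 ?addn0 ?andbT.
  have muk : (hmu h k == x.+1) by lia.
  move: totW talW; rewrite muk mul1n /= => totW talW.
  apply: wp_seq; apply: wp_assign; rewrite /= ?H1 //.
  apply: wp_seq; apply: wp_assign; rewrite /= /update /= H2 x1 t1 (ho_n hs1) (ho_m hs1) (ho_hp hs1) //.
  apply: wp_if => /=; rewrite /update /= x1 t1 (ho_n hs1) (ho_hp hs1) => E2.
    by split=> //=; rewrite /update /= ?H1 ?H3 /hu /hitem ?E2 ?andbT.
  by apply: wp_assign => //; split=> //=; rewrite /update /= ?H1 /hu /hitem ?E2 ?andbF.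
- by rewrite (ho_m hs).
Qed.


Lemma wp_check_courses s (ok : bool) :
  ready s -> sc s xok = ok ->
  wp check_courses (fun s' => sc s' xok = ok && all_below (course_ok h n m) n) s.
Proof.
move=> hs sok; have [mW nW] := ready_leq hs.
pose Inv k s' := sc s' xok = ok && all_below (course_ok h n m) k.
apply: (@wp_for _ _ _ _ _ Inv); rewrite /= ?(ho_n hs) //.
- exact: ho_bounded hs.
- by rewrite /Inv andbT.
- move=> x s' ltxn fs' _ I.
  have hs1 : ready (setv s' xx x) by apply: holds_setv; [apply: holds_framed fs' _ _ _| |lia].
  have [x1 I1] : sc (setv s' xx x) xx = x /\ Inv x (setv s' xx x) by [].
  move: (setv s' xx x) hs1 x1 I1 => s1 hs1 x1 I1.
  apply: wp_seq; apply: wp_assign => //; apply: wp_seq; apply: wp_assign => //=.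
  set s2 := setv _ _ _; have hs2 : ready s2 by do 2!(apply: holds_setv => //).
  apply: wp_seq; apply: (wp_cut (ho_bounded hs2)).
    by apply: (wp_scan hs2 (x := x) (ok := ok && all_below (course_ok h n m) x)).
  move=> s3 fs3 [n3 t3 o3].
  have hs3 : ready s3 by apply: holds_framed fs3 _ _ _.
  have x3 : sc s3 xx = x by rewrite (fr_sc fs3).
  move: s3 {fs3 fs'} hs3 x3 n3 t3 o3 => s3 hs3 x3 n3 t3 o3.
  apply: wp_seq; apply: (wp_cut (ho_bounded hs3)
    (R := fun s' => sc s' xok = [&& ok && all_below (course_ok h n m) x,
       all_below (acceptable h n x) m & tally h x m == hcap h n m x])).
    apply: wp_if => /=; rewrite n3 x3 (ho_n hs3) (ho_m hs3) (ho_hp hs3) -/(hitem _ _) -/(hcap _ _ _ _) => E.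
      apply: wp_assign => //=; rewrite /update /=.
      by have -> : (tally h x m == hcap h n m x) = false; [lia|rewrite !andbF].
    rewrite /wp /= o3; have -> : (tally h x m == hcap h n m x) by lia.
    by rewrite andbT.
  move=> s4 fs4 o4.
  have hs4 : ready s4 by apply: holds_framed fs4 _ _ _.
  have [x4 t4] : sc s4 xx = x /\ sc s4 xsum = total h n m x m by rewrite !(fr_sc fs4).
  rewrite /Inv /= /course_ok.
  apply: wp_if => /=; rewrite t4 x4 (ho_n hs4) (ho_m hs4) (ho_hp hs4)
    -!/(hitem _ _) -/(hcap _ _ _ _) -/(hk h n m 0) -/(hk h n m 1) => E.
    apply: wp_assign => //=; rewrite /update /=.
    by rewrite leqNgt -subn_gt0 E !andbF.
  rewrite /wp /= o4 -!andbA; have -> : (hcap h n m x * hk h n m 0 <= hk h n m 1 * total h n m x m).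
    by rewrite -subn_eq0 E.
  by rewrite andbT.
Qed.

Lemma wp_check_pair s ti tj (ok : bool) :
  ready s -> sc s xt = ti -> sc s xt2 = tj -> sc s xok = ok ->
  wp check_pair (fun s' => sc s' xok = ok && envy_free h n m ti tj) s.
Proof.
move=> hs si sj so; have [mW nW] := ready_leq hs.
have bs := ho_bounded hs.
rewrite /envy_free; apply: wp_if; rewrite /= sj (ho_hp hs) -/(hmu h tj); last first.
  by move=> E; rewrite E andbT.
case muj : (hmu h tj) => [|x] // _.
have xW : x.+1 <= W by rewrite -muj /hmu -(ho_hp hs); apply: bs.2.
apply: wp_seq; apply: wp_assign; rewrite /= sj (ho_hp hs) -/(hmu h tj) muj subn1 /=; first by lia.
set s1 := setv _ _ _.
have hs1 : ready s1 by apply: holds_setv => //; lia.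
apply: wp_seq; apply: wp_assign => //=; set s2 := setv _ _ _.
have hs2 : ready s2 by apply: holds_setv.
have [i2 j2 x2 o2] : [/\ sc s2 xt = ti, sc s2 xt2 = tj, sc s2 xx = x & sc s2 xok = ok] by [].
have n2 : sc s2 xnum = 0 by [].
move: s2 hs2 i2 j2 x2 o2 n2 => s2 hs2 i2 j2 x2 o2 n2.
apply: wp_seq; apply: (wp_cut (ho_bounded hs2) (R := fun s' => sc s' xnum = hutil h n ti)).
  rewrite /hutil; apply: wp_if => /=; rewrite i2 (ho_hp hs2) -/(hmu h ti).
    case mui : (hmu h ti) => [|y] // _.
    apply: wp_assign; rewrite /= i2 (ho_n hs2) (ho_hp hs2) -/(hmu h ti) mui subn1 //.
    by rewrite -(ho_hp hs2); apply: (ho_bounded hs2).2.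
  by move=> E; rewrite E.
move=> s3 fs3 n3.
have hs3 : ready s3 by apply: holds_framed fs3 _ _ _.
have [i3 j3 x3 o3] : [/\ sc s3 xt = ti, sc s3 xt2 = tj, sc s3 xx = x & sc s3 xok = ok].
  by split; rewrite (fr_sc fs3).
have gE t b : h (2 * (n * m + (2 * (t * n + x) + b)) + 1) = hg h n m t x b by [].
apply: wp_if => /=; rewrite i3 j3 x3 (ho_n hs3) (ho_m hs3) (ho_hp hs3) !gE.
  by rewrite subn_gt0 => E; rewrite /wp /= o3 E andbT.
move/eqP; rewrite subn_eq0 leqNgt => /negbTE ->.
apply: wp_if => /=; rewrite i3 x3 n3 (ho_n hs3) (ho_hp hs3) -/(hitem _ _) -/(hu _ _ _ _) => E.
  by apply: wp_assign => //=; rewrite leqNgt -subn_gt0 E andbF.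
by rewrite /wp /= o3 -subn_eq0 E andbT.
Qed.

Lemma wp_check_envy s (ok : bool) :
  ready s -> sc s xok = ok ->
  wp check_envy (fun s' => sc s' xok =
    ok && all_below (fun ti => all_below (envy_free h n m ti) m) m) s.
Proof.
move=> hs sok; have [mW nW] := ready_leq hs.
pose Inv k s' := sc s' xok = ok && all_below (fun ti => all_below (envy_free h n m ti) m) k.
apply: (@wp_for _ _ _ _ _ Inv); rewrite /= ?(ho_m hs) //.
- exact: ho_bounded hs.
- by rewrite /Inv andbT.
move=> ti s' lti fs' _ I.
have hs1 : ready (setv s' xt ti) by apply: holds_setv; [apply: holds_framed fs' _ _ _| |lia].
have [t1 I1] : sc (setv s' xt ti) xt = ti /\ Inv ti (setv s' xt ti) by [].
move: (setv s' xt ti) hs1 t1 I1 {fs'} => s1 hs1 t1 I1.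
pose Inv2 k s' := sc s' xok = (ok && all_below (fun ti => all_below (envy_free h n m ti) m) ti)
   && all_below (envy_free h n m ti) k.
apply: (@wp_for _ _ _ _ _ Inv2); rewrite /= ?(ho_m hs1) //.
- exact: ho_bounded hs1.
- by rewrite /Inv2 andbT.
- move=> tj s2 ltj fs2 _ I2.
  rewrite /Inv2 /= andbA; apply: wp_check_pair => //.
    by apply: holds_setv; [apply: holds_framed fs2 _ _ _| |lia].
  by rewrite /= /update /= (fr_sc fs2).
- by move=> s2 _; rewrite /Inv2 -andbA.
Qed.

Lemma wp_check s :
  ready s -> wp check (fun s' => sc s' xok = valid h n m) s.
Proof.
move=> hs; apply: wp_seq; apply: wp_assign => /=; first by lia.
have hs1 : ready (setv s xok 1) by apply: holds_setv => //; lia.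
apply: wp_seq; apply: (wp_cut (ho_bounded hs1)).
  exact: (wp_check_courses hs1 (ok := true)).
move=> s2 fs2 o2; apply: wp_check_envy => //.
exact: holds_framed fs2 _ _ _.
Qed.

End Specs.

(** * Input, enumeration of candidates and output *)

Definition read_items : cmd :=
  For xt (Plus (Times (Lit 4) (Times (Var xn) (Var xm))) (Plus (Var xn) (Lit 2)))
    (Read xrem ;; Put (Plus (Times (Lit 2) (Var xt)) (Lit 1)) (Var xrem)).

Definition count_candidates : cmd :=
  Assign xcount (Lit 1) ;;
  For xt (Var xm) (Assign xcount (Times (Var xcount) (Plus (Var xn) (Lit 1)))).

(** Counted loops have no early exit, so later hits overwrite earlier ones. [xbest] is one more than
    the last valid index, and 0 if there is none. *)
Definition search : cmd :=
  Assign xbest (Lit 0) ;;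
  For xi (Var xcount)
    (decode ;; check ;; If (Var xok) (Assign xbest (Plus (Var xi) (Lit 1))) Skip).

(** The heap holds the last candidate tried, so the chosen one is decoded again. *)
Definition answer : cmd :=
  If (Var xbest)
    (Write (Lit 1) ;; Assign xi (Minus (Var xbest) (Lit 1)) ;; decode ;;
     For xt (Var xm) (Write (emu (Var xt))))
    (Write (Lit 0)).

(** If [n > m] the items stay unread, as their number is then not bounded in terms of [m]. *)
Definition solve : cmd :=
  Read xn ;; Read xm ;;
  If (Minus (Var xn) (Var xm)) (Write (Lit 0))
    (read_items ;; count_candidates ;; search ;; answer).

Section Solve.
Variables (W Z : nat).
Hypothesis W64 : 64 <= W.
Local Notation wp := (wp W Z).
Local Notation bounded := (bounded W).

Lemma wp_solve_large (n m : nat) D :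
  m < n -> n <= W -> wp solve (fun s => out s = [:: 0]) (start [:: n, m & D]).
Proof.
move=> ltmn nW; apply: wp_seq; split=> //=; apply: wp_seq; split=> /=; first by lia.
by apply: wp_if => //=; rewrite /update /=; lia.
Qed.

Variables (n m B : nat) (D : seq nat) (ok : nat -> bool).
Hypothesis nm : n <= m.
Hypothesis ZW : Z <= W.
Hypothesis sizeD : size D = 4 * (n * m) + (n + 2).
Hypothesis DZ : size D <= Z.
Hypothesis countZ : n.+1 ^ m <= Z.
Hypothesis mZ : m <= Z.
Hypothesis DB : forall i, nth 0 D i <= B.
Hypothesis BW : B <= W.
Hypothesis mBW : m * B <= W.
(** The verdict depends on the heap only through the digits and the items, so it can be named [ok i]
    independently of the run. *)
Hypothesis okP : forall h i,
  (forall t, t < m -> h (2 * t) = digit n i t) -> (forall j, h (2 * j + 1) = nth 0 D j) ->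
  valid h n m = ok i.

Definition solution o :=
  (exists i, [/\ i < n.+1 ^ m, ok i & o = 1 :: [seq digit n i t | t <- iota 0 m]]) \/
  ((forall i, i < n.+1 ^ m -> ~~ ok i) /\ o = [:: 0]).

Definition loaded s := [/\ bounded s, sc s xn = n, sc s xm = m, out s = [::]
  & forall j, hp s (2 * j + 1) = nth 0 D j].

Lemma wp_read_items s :
  bounded s -> sc s xn = n -> sc s xm = m -> out s = [::] -> (forall j, hp s j = 0) ->
  inp s = D -> wp read_items loaded s.
Proof.
move=> bs sn sm so sh si.
pose Inv k s' := inp s' = drop k D /\
  forall j, hp s' (2 * j + 1) = if j < k then nth 0 D j else 0.
apply: (@wp_for _ _ _ _ _ Inv); rewrite /= ?sn ?sm -?sizeD //.
- exact: leq_trans DZ ZW.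
- by split=> //; rewrite drop0.
- move=> k s' ltk fs' bs' [I1 I2].
  have kB : head 0 (inp s') = nth 0 D k by rewrite I1 -nth0 nth_drop addn0.
  apply: wp_seq; split; rewrite /= kB; first exact: leq_trans (DB k) BW.
  apply: wp_put; rewrite /= /update /=; first exact: leq_trans (DB k) BW.
  split=> /=; first by rewrite I1 -drop1 drop_drop add1n.
  move=> j; rewrite /update; case: eqP => [e|ne].
    have -> : j = k by lia.
    by rewrite ltnSn.
  by rewrite I2; have -> : (j < k.+1) = (j < k) by lia.
- move=> s' fs' [_ I2]; split=> /=.
  + by apply: bounded_setv; [exact: fr_bounded fs'|exact: leq_trans DZ ZW].
  + by rewrite /update /= (fr_sc fs').
  + by rewrite /update /= (fr_sc fs').
  + by rewrite (fr_out fs').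
  (* Beyond the end of [D] the untouched cells hold 0, which is also the default of [nth]. *)
  + by move=> j; rewrite I2; case: ltnP => // H; rewrite nth_default.
Qed.

Lemma loaded_framed c s s' : loaded s -> framed W c s s' ->
  ~~ puts c -> ~~ writes c -> xn \notin written c -> xm \notin written c -> loaded s'.
Proof.
case=> _ sn sm so sh [b v hh _ o] np nw nn nM.
by split; rewrite ?v ?o ?hh.
Qed.

Lemma wp_count_candidates s :
  loaded s -> wp count_candidates (fun s' => loaded s' /\ sc s' xcount = n.+1 ^ m) s.
Proof.
move=> ls; have bs : bounded s by case: ls.
apply: (wp_cut bs (R := fun s' => sc s' xcount = n.+1 ^ m)); last first.
  by move=> s' fs' e; split=> //; apply: loaded_framed fs' _ _ _ _.
apply: wp_seq; apply: wp_assign => //=; first by lia.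
have [_ sn sm _ _] := ls; have mW : m <= W by lia.
set s1 := setv _ _ _; have bs1 : bounded s1 by apply: bounded_setv => //; lia.
pose Inv k s' := sc s' xcount = n.+1 ^ k.
have sm1 : sc s1 xm = m by [].
have sn1 : sc s1 xn = n by [].
have inv0 : Inv 0 s1 by [].
move: s1 bs1 sm1 sn1 inv0 => s1 bs1 sm1 sn1 inv0.
apply: (@wp_for _ _ _ _ _ Inv); rewrite /= ?sm1 //.
move=> k s' ltk fs' bs'; rewrite /Inv => I.
have n' : sc s' xn = n by rewrite (fr_sc fs').
apply: wp_assign; rewrite /= /update /= n' I addn1 -expnSr //.
by apply: leq_trans ZW; apply: leq_trans countZ; rewrite leq_pexp2l.
Qed.

Definition best_below i s :=
  (sc s xbest = 0 /\ forall i', i' < i -> ~~ ok i') \/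
  (exists i', [/\ i' < i, ok i' & sc s xbest = i'.+1]).

(** [decode] writes to the heap, so [loaded_framed] does not apply; but it alters even cells only,
    and [loaded] speaks of odd ones. *)
Lemma loaded_decode s i :
  loaded s -> sc s xi = i -> i <= Z ->
  wp decode (fun s' => [/\ loaded s', framed W decode s s' & 
     forall t, t < m -> hp s' (2 * t) = digit n i t]) s.
Proof.
move=> [bs sn sm so sh] si iZ.
apply: (wp_cut bs (wp_decode (Z := Z) W64 bs _ _)); rewrite ?sm ?si ?sn //.
move=> s' fs' [H1 H2]; split=> //; split; rewrite ?(fr_sc fs') ?(fr_out fs') //.
  exact: fr_bounded fs'.
by move=> j; rewrite H2.
Qed.

Lemma wp_search s :
  loaded s -> sc s xcount = n.+1 ^ m ->
  wp search (fun s' => loaded s' /\ best_below (n.+1 ^ m) s') s.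
Proof.
move=> ls sN; have bs : bounded s by case: ls.
apply: wp_seq; apply: wp_assign => //=.
set s1 := setv _ _ _; have bs1 : bounded s1 by apply: bounded_setv.
have sN1 : sc s1 xcount = n.+1 ^ m by [].
have ls1 : loaded s1 by case: ls.
have b1 : sc s1 xbest = 0 by [].
move: s1 bs1 sN1 ls1 b1 => s1 bs1 sN1 ls1 b1.
pose Inv i s' := loaded s' /\ best_below i s'.
have NW : n.+1 ^ m <= W by lia.
apply: (@wp_for _ _ _ _ _ Inv); rewrite /= ?sN1 //.
- by split=> //; left.
- move=> i s' lti fs' bs' [I1 I2].
  have ls' : loaded (setv s' xi i) by case: I1.
  apply: wp_seq; apply: wp_mono (loaded_decode (i := i) ls' _ _) => //; last by lia.
  move=> s2 [ls2 fs2 dig2].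
  have [bs2 sn2 sm2 so2 sh2] := ls2.
  have i2 : sc s2 xi = i by rewrite (fr_sc fs2).
  have best2 : sc s2 xbest = sc s' xbest by rewrite (fr_sc fs2).
  have nZ : n <= Z by lia.
  have h2 : holds W (hp s2) n m s2 by [].
  have itemB j : hitem (hp s2) j <= B by rewrite /hitem sh2.
  apply: wp_seq; apply: (wp_cut bs2 (wp_check (Z := Z) W64 mZ nZ itemB mBW h2)).
  move=> s3 fs3; rewrite (okP dig2 sh2) => ok3.
  have ls3 : loaded s3 by apply: loaded_framed fs3 _ _ _ _.
  have i3 : sc s3 xi = i by rewrite (fr_sc fs3).
  have best3 : sc s3 xbest = sc s' xbest by rewrite (fr_sc fs3).
  apply: wp_if; rewrite /= ok3 => oki.
    apply: wp_assign; rewrite /= i3 addn1; first by lia.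
    split.
      by case: ls3 => l1 l2 l3 l4 l5; split=> //; apply: bounded_setv => //; lia.
    by right; exists i; split=> //; case: (ok i) oki.
  split=> //; case: I2 => [[e H]|[i' [lti' oki' e]]]; [left|right].
    split; first by rewrite best3.
    move=> i'; rewrite ltnS leq_eqVlt => /predU1P[->|/H//].
    by case: (ok i) oki.
  by exists i'; split; rewrite ?best3 //; lia.
- move=> s' fs' [[l1 l2 l3 l4 l5] I2]; split=> //.
  by split=> //; apply: bounded_setv.
Qed.

Lemma wp_answer s :
  loaded s -> best_below (n.+1 ^ m) s -> wp answer (fun s' => solution (out s')) s.
Proof.
move=> ls best; apply: wp_if => /= b0; last first.
  case: best => [[_ H]|[i [_ _ H]]]; last by rewrite H in b0.
  by right; split=> //=; case: ls => _ _ _ -> _.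
case: best => [[H _]|[i [iN oki e]]]; first by rewrite H in b0.
have [bs sn sm so sh] := ls.
have iW : i <= W by lia.
apply: wp_seq; apply: wp_write; rewrite so; apply: wp_seq; apply: wp_assign; rewrite /= e subn1 //=.
set s1 := setv _ _ _; have bs1 : bounded s1 by apply: bounded_setv.
have [n1 m1 i1 o1] : [/\ sc s1 xn = n, sc s1 xm = m, sc s1 xi = i & out s1 = [:: 1]] by [].
have i1Z : sc s1 xi <= Z by rewrite i1; lia.
have m1Z : sc s1 xm <= Z by rewrite m1.
apply: wp_seq; apply: (wp_cut bs1 (wp_decode W64 bs1 m1Z i1Z)).
rewrite m1 n1 i1 => s2 fs2 [dig _].
have m2 : sc s2 xm = m by rewrite (fr_sc fs2).
have o2 : out s2 = [:: 1] by rewrite (fr_out fs2).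
pose Inv k s' := out s' = 1 :: [seq digit n i t | t <- iota 0 k].
apply: (@wp_for _ _ _ _ _ Inv); rewrite /= ?m2 //.
- exact: fr_bounded fs2.
- by lia.
- move=> k s' ltk fs' bs'; rewrite /Inv => I; apply: wp_write.
  by rewrite -[k.+1]addn1 iotaD map_cat /= I add0n cats1 (fr_hp fs') // dig.
- by move=> s' fs' I; left; exists i.
Qed.

Lemma wp_solve : wp solve (fun s => solution (out s)) (start [:: n, m & D]).
Proof.
have mW : m <= W by lia.
have nW : n <= W by lia.
apply: wp_seq; split=> //=; apply: wp_seq; split=> //=.
apply: wp_if; rewrite /= /update /=; first by lia.
move=> _; set s := State _ _ _ _.
have bs : bounded s by split=> // y; rewrite /= /update; do 2!case: ifP => // _.
apply: wp_seq; apply: wp_mono (wp_read_items bs _ _ _ _ _) => // s1 l1.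
apply: wp_seq; apply: wp_mono (wp_count_candidates l1) => s2 [l2 c2].
apply: wp_seq; apply: wp_mono (wp_search l2 c2) => s3 [l3 b3].
exact: wp_answer.
Qed.

End Solve.
(** * Instances in memory *)

Section Encoding.

(** Row-major addressing, used both for the rows of a table and for the pairs that encode
    rationals. *)
Lemma nth_flatten_uniform (T : Type) (x0 : T) b (ss : seq (seq T)) i j :
  all (fun s => size s == b) ss -> i < size ss -> j < b ->
  nth x0 (flatten ss) (i * b + j) = nth x0 (nth [::] ss i) j.
Proof.
elim: ss i => // s ss IH [|i] /= /andP[/eqP sb al] lti ltj.
  by rewrite mul0n add0n nth_cat sb ltj.
by rewrite nth_cat sb mulSn -addnA ltnNge leq_addr /= addKn IH.
Qed.

Lemma nth_allpairs_enum (T : Type) (x0 : T) a b (f : 'I_a -> 'I_b -> T) (i : 'I_a) (j : 'I_b) :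
  nth x0 [seq f x y | x <- enum 'I_a, y <- enum 'I_b] (i * b + j) = f i j.
Proof.
rewrite nth_flatten_uniform 1?size_map ?size_enum_ord //.
  by rewrite (nth_map i) ?size_enum_ord // (nth_map j) ?size_enum_ord // !nth_ord_enum.
by rewrite all_map; apply/allP => x _ /=; rewrite size_map size_enum_ord.
Qed.

Lemma size_flatten_uniform (T : Type) b (ss : seq (seq T)) :
  all (fun s => size s == b) ss -> size (flatten ss) = size ss * b.
Proof. by elim: ss => //= s ss IH /andP[/eqP sb /IH e]; rewrite size_cat sb e mulSn. Qed.

Variable I : instance.
Let n := ncourses I.
Let m := ntas I.

Definition rats := [seq encode_rat (g t x) | t <- enum 'I_(ntas I), x <- enum 'I_(ncourses I)].

Definition items : seq nat :=
  [seq u t x | t <- enum 'I_(ntas I), x <- enum 'I_(ncourses I)]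
  ++ flatten rats
  ++ [seq cap x | x <- enum 'I_(ncourses I)]
  ++ [seq v x t | x <- enum 'I_(ncourses I), t <- enum 'I_(ntas I)]
  ++ encode_rat (k I).

Lemma encodeE : encode I = [:: ncourses I, ntas I & items].
Proof. by []. Qed.

Lemma rats_uniform : all (fun s => size s == 2) rats.
Proof. by apply/allP => s /allpairsP[[t x] [_ _ ->]]. Qed.

Lemma size_rats : size rats = n * m.
Proof. by rewrite size_allpairs !size_enum_ord mulnC. Qed.

Lemma size_items : size items = 4 * (n * m) + (n + 2).
Proof.
rewrite !size_cat !size_allpairs (size_flatten_uniform rats_uniform) size_rats size_map.
by rewrite !size_enum_ord -/n -/m /=; lia.
Qed.

Lemma nth_items_u (t : 'I_m) (x : 'I_n) : nth 0 items (t * n + x) = u t x.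
Proof.
rewrite nth_cat size_allpairs !size_enum_ord ifT; first exact: nth_allpairs_enum.
by have := ltn_ord t; have := ltn_ord x; rewrite -/n -/m; nia.
Qed.

Lemma nth_items_g (t : 'I_m) (x : 'I_n) b : b < 2 ->
  nth 0 items (n * m + (2 * (t * n + x) + b)) = nth 0 (encode_rat (g t x)) b.
Proof.
move=> b2; have tx : t * n + x < n * m by have := ltn_ord t; have := ltn_ord x; nia.
rewrite /items nth_cat size_allpairs !size_enum_ord -/n -/m [m * n]mulnC ltnNge leq_addr /= addKn.
rewrite nth_cat (size_flatten_uniform rats_uniform) size_rats ifT; last by lia.
rewrite [2 * _]mulnC nth_flatten_uniform ?size_rats ?rats_uniform //.
by rewrite nth_allpairs_enum.
Qed.

Lemma nth_items_cap (x : 'I_n) : nth 0 items (3 * (n * m) + x) = cap x.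
Proof.
rewrite /items nth_cat size_allpairs !size_enum_ord -/n -/m ifF; last by lia.
rewrite nth_cat (size_flatten_uniform rats_uniform) size_rats ifF; last by lia.
rewrite nth_cat size_map size_enum_ord -/n.
have -> : 3 * (n * m) + x - m * n - n * m * 2 = x by lia.
by rewrite ltn_ord (nth_map x) ?size_enum_ord // nth_ord_enum.
Qed.

Lemma nth_items_v (x : 'I_n) (t : 'I_m) :
  nth 0 items (3 * (n * m) + (n + (x * m + t))) = v x t.
Proof.
have tx : x * m + t < n * m by have := ltn_ord t; have := ltn_ord x; nia.
rewrite /items nth_cat size_allpairs !size_enum_ord -/n -/m ifF; last by lia.
rewrite nth_cat (size_flatten_uniform rats_uniform) size_rats ifF; last by lia.
rewrite nth_cat size_map size_enum_ord -/n ifF; last by lia.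
have -> : 3 * (n * m) + (n + (x * m + t)) - m * n - n * m * 2 - n = x * m + t by lia.
by rewrite nth_cat size_allpairs !size_enum_ord -/n -/m tx nth_allpairs_enum.
Qed.

Lemma nth_items_k b : nth 0 items (4 * (n * m) + (n + b)) = nth 0 (encode_rat (k I)) b.
Proof.
rewrite /items nth_cat size_allpairs !size_enum_ord -/n -/m ifF; last by lia.
rewrite nth_cat (size_flatten_uniform rats_uniform) size_rats ifF; last by lia.
rewrite nth_cat size_map size_enum_ord -/n ifF; last by lia.
rewrite nth_cat size_allpairs !size_enum_ord -/n -/m ifF; last by lia.
by congr nth; lia.
Qed.

(** The bit length of [w] is one of the summands of [isize I]. *)
Lemma mem_encode_lt w : w \in encode I -> w < 2 ^ isize I.
Proof.
move=> we; apply: leq_trans (ltn_bitlen w) _; rewrite leq_exp2l // /isize.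
by rewrite (big_rem w) //= leq_addr.
Qed.

Lemma items_leq i : nth 0 items i <= 2 ^ isize I.
Proof.
case: (ltnP i (size items)) => H; last by rewrite nth_default.
by apply/ltnW/mem_encode_lt; rewrite encodeE !inE mem_nth ?orbT.
Qed.

End Encoding.

(** * Rational comparisons by cross-multiplication *)

Section RatComparison.
Import Order.TTheory GRing.Theory Num.Theory.
Local Open Scope ring_scope.

Lemma nonneg_ratE (q : rat) : 0 <= q ->
  q = (absz (numq q))%:R / (absz (denq q))%:R.
Proof.
move=> q0; have e1 : numq q = (absz (numq q) : int) by rewrite gez0_abs // numq_ge0.
have e2 : denq q = (absz (denq q) : int) by rewrite gez0_abs // denq_ge0.
by rewrite -{1}[q]divq_num_den {1}e1 {1}e2 -!pmulrn.
Qed.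

Lemma le_rat_abs (a b : rat) : 0 <= a -> 0 <= b ->
  (a <= b) = (absz (numq a) * absz (denq b) <= absz (numq b) * absz (denq a))%N.
Proof.
move=> a0 b0; rewrite {1}[a]nonneg_ratE // {1}[b]nonneg_ratE //.
have da : 0 < (absz (denq a))%:R :> rat by rewrite ltr0n absz_gt0 denq_eq0.
have db : 0 < (absz (denq b))%:R :> rat by rewrite ltr0n absz_gt0 denq_eq0.
by rewrite ler_pdivrMr // mulrAC ler_pdivlMr // -!natrM ler_nat.
Qed.

Lemma le_average (q : rat) (c s : nat) : 0 <= q -> (0 < c)%N ->
  (q <= c%:R^-1 * s%:R) = (c * absz (numq q) <= absz (denq q) * s)%N.
Proof.
move=> q0 c0; rewrite {1}[q]nonneg_ratE //.
have dq : 0 < (absz (denq q))%:R :> rat by rewrite ltr0n absz_gt0 denq_eq0.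
have cq : 0 < c%:R :> rat by rewrite ltr0n.
by rewrite ler_pdivrMr // -mulrA ler_pdivlMl // -!natrM ler_nat [(s * _)%N]mulnC.
Qed.

End RatComparison.

(** * Candidate numbers and matchings *)

Lemma digit_leq n i t : digit n i t <= n.
Proof. by rewrite -ltnS ltn_mod. Qed.

Lemma digits_surj n (ds : nat -> nat) m :
  (forall t, t < m -> ds t <= n) ->
  exists2 i, i < n.+1 ^ m & forall t, t < m -> digit n i t = ds t.
Proof.
elim: m ds => [|m IH] ds H; first by exists 0.
have [i im Hi] := IH (fun t => ds t.+1) (fun t tm => H t.+1 tm).
have d0 := H 0 isT.
exists (i * n.+1 + ds 0).
  by rewrite expnSr; move: im; move: (n.+1 ^ m) => N; nia.
case=> [|t] tm.
  by rewrite /digit expn0 divn1 modnMDl modn_small.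
by rewrite -Hi // /digit expnS divnMA divnMDl // [ds 0 %/ _]divn_small // addn0.
Qed.

Section Matchings.
Variable I : instance.
Let n := ncourses I.
Let m := ntas I.

(** A digit is at most [n], so [insub] always succeeds and [None] arises from the digit 0 only. *)
Definition candidate (i : nat) : matching I :=
  [ffun t : 'I_(ntas I) => if digit (ncourses I) i t is x.+1 then insub x else None].

Lemma candidateE i (t : 'I_m) (x : 'I_n) :
  (candidate i t == Some x) = (digit n i t == x.+1).
Proof.
rewrite ffunE -/n; case: (digit n i t) (digit_leq n i t) => [|y] // yn.
by rewrite eqSS insubT //=; apply/eqP/eqP => [[<-]|<-] //; congr Some; apply: val_inj.
Qed.

Lemma candidate_digit i (t : 'I_m) :
  digit n i t = if candidate i t is Some x then (x : nat).+1 else 0.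
Proof.
case e: (candidate i t) => [x|]; first by apply/eqP; rewrite -candidateE e.
move: e; rewrite ffunE -/n; case: (digit n i t) (digit_leq n i t) => [|y] // yn.
by rewrite insubT.
Qed.

Lemma candidate_surj (mu : matching I) :
  exists2 i, i < n.+1 ^ m & mu = candidate i.
Proof.
pose ds t := if insub t is Some t' then
  (if mu t' is Some x then (x : nat).+1 else 0) else 0.
have [t _|i im H] := @digits_surj n ds m.
  by rewrite /ds; case: insubP => // t' _ _; case: (mu t').
exists i => //; apply/ffunP => t.
have := H t (ltn_ord t); rewrite /ds valK candidate_digit.
case: (mu t) => [x|]; case: (candidate i t) => [y|] // [e].
by congr Some; apply: val_inj.
Qed.

(** The digit convention is that of the output format, so the program writes digits without
    translating them. *)
Lemma encode_candidate i :
  encode_answer (Some (candidate i)) = 1 :: [seq digit n i t | t <- iota 0 m].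
Proof.
rewrite /= -(val_enum_ord m) -map_comp; congr (_ :: _).
by apply: eq_map => t /=; rewrite candidate_digit.
Qed.

Variables (h : nat -> nat) (i : nat).
Hypothesis hD : forall t, t < m -> h (2 * t) = digit n i t.
Hypothesis hI : forall j, h (2 * j + 1) = nth 0 (items I) j.
Let mu := candidate i.

Lemma hmuE (t : 'I_m) (x : 'I_n) : (hmu h t == x.+1) = (mu t == Some x).
Proof. by rewrite /hmu hD // candidateE. Qed.

Lemma huE (t : 'I_m) (x : 'I_n) : hu h n t x = u t x.
Proof. by rewrite /hu /hitem hI nth_items_u. Qed.

Lemma hvE (x : 'I_n) (t : 'I_m) : hv h n m x t = v x t.
Proof. by rewrite /hv /hitem hI nth_items_v. Qed.

Lemma hcapE (x : 'I_n) : hcap h n m x = cap x.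
Proof. by rewrite /hcap /hitem hI nth_items_cap. Qed.

Lemma tallyE (x : 'I_n) : tally h x m = #|[set t | mu t == Some x]|.
Proof.
rewrite -sum1_card big_mkcond /=; apply: eq_bigr => t _.
by rewrite inE hmuE; case: eqP.
Qed.

Lemma totalE (x : 'I_n) : total h n m x m = \sum_(t | mu t == Some x) v x t.
Proof.
rewrite [RHS]big_mkcond /=; apply: eq_bigr => t _.
by rewrite hmuE hvE; case: eqP; rewrite ?mul1n.
Qed.

Lemma course_okP (x : 'I_n) :
  reflect [/\ forall t, mu t = Some x -> u t x <> 0,
     #|[set t | mu t == Some x]| = cap x & (k I <= avg_util mu x)%R]
  (course_ok h n m x).
Proof.
rewrite /course_ok tallyE hcapE totalE.
have -> : (cap x * hk h n m 0 <= hk h n m 1 * \sum_(t | mu t == Some x) v x t) =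
    (k I <= avg_util mu x)%R.
  rewrite /avg_util -GRing.natr_sum le_average ?k_ge0 ?cap_gt0 //.
  by rewrite /hk /hitem !hI !nth_items_k.
have E : reflect (forall t, mu t = Some x -> u t x <> 0) (all_below (acceptable h n x) m).
  apply: (iffP (all_belowP _ _)) => H t.
    by move=> e; have := H t (ltn_ord t); rewrite /acceptable hmuE e eqxx huE /=; case: (u t x).
  move=> tm; have := H (Ordinal tm); rewrite /acceptable.
  rewrite (hmuE (Ordinal tm)) (huE (Ordinal tm)).
  by case: eqP => //= -> /(_ erefl); case: (u _ x).
apply: (iffP and3P) => [[/E ? /eqP ? ?]|[? ? ?]]; split=> //; first exact/E.
exact/eqP.
Qed.

Lemma envy_freeP (ti tj : 'I_m) :
  reflect (forall x, mu tj = Some x -> (g tj x <= g ti x)%R -> u ti x <= util ti (mu ti))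
    (envy_free h n m ti tj).
Proof.
rewrite /envy_free.
have hd (t : 'I_m) : hmu h t = if mu t is Some x then (x : nat).+1 else 0.
  by rewrite /hmu hD // candidate_digit.
rewrite (hd tj); case e : (mu tj) => [x|]; last by left.
have -> : hutil h n ti = util ti (mu ti).
  by rewrite /hutil hd; case: (mu ti) => //= y; rewrite huE.
rewrite huE.
have -> : (hg h n m ti x 0 * hg h n m tj x 1 < hg h n m tj x 0 * hg h n m ti x 1) =
   ~~ (g tj x <= g ti x)%R.
  by rewrite /hg /hitem !hI !nth_items_g // le_rat_abs ?g_ge0 // -ltnNge /=.
rewrite -implybE.
apply: (iffP implyP) => [H y [<-]//|H]; exact: H.
Qed.

Lemma validP : reflect (MEFE mu) (valid h n m).
Proof.
apply: (iffP andP) => [[/all_belowP C /all_belowP E]|[[capE uE] sat ef]].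
  have {}C x := course_okP x (C x (ltn_ord x)).
  split; [split|..].
  - by move=> x; case: (C x).
  - by move=> [t [x [e u0]]]; case: (C x) => H _ _; apply: (H t).
  - by move=> x; case: (C x).
  - move=> [ti [tj [x [e gle lt]]]].
    have /all_belowP/(_ tj (ltn_ord tj))/envy_freeP := E ti (ltn_ord ti).
    by move=> /(_ x e gle); move: lt; rewrite e /=; lia.
split; apply/all_belowP.
  move=> x xn; apply/(course_okP (Ordinal xn)); split; [|exact: capE|exact: sat].
  by move=> t e u0; apply: uE; exists t, (Ordinal xn).
move=> ti tim; apply/all_belowP => tj tjm.
apply/(envy_freeP (Ordinal tim) (Ordinal tjm)) => x e gle.
rewrite leqNgt; apply/negP => lt; apply: ef.
by exists (Ordinal tim), (Ordinal tjm), x; split=> //; rewrite e.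
Qed.

End Matchings.

Lemma feasible_courses_leq (I : instance) (mu : matching I) :
  feasible mu -> ncourses I <= ntas I.
Proof.
case=> capE _.
have ex x : exists t, mu t == Some x.
  have : 0 < #|[set t | mu t == Some x]| by rewrite capE cap_gt0.
  by case/card_gt0P => t; rewrite inE; exists t.
rewrite -[ncourses I]card_ord -[ntas I]card_ord.
(* Choosing one TA per course is injective, since a TA is assigned to at most one course. *)
apply: (@leq_card _ _ (fun x => xchoose (ex x))) => x y e.
have /eqP ex1 := xchooseP (ex x); have /eqP ex2 := xchooseP (ex y).
by apply: Some_inj; rewrite -ex1 -ex2 e.
Qed.

(** * Running time *)

Fixpoint depth c := match c with
  | Seq c1 c2 | If _ c1 c2 => maxn (depth c1) (depth c2)
  | For _ _ b => (depth b).+1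
  | _ => 0 end.

Fixpoint csize c := match c with
  | Seq c1 c2 => csize c1 + csize c2
  | If _ c1 c2 => (csize c1 + csize c2).+1
  | For _ _ b => (csize b).+2
  | _ => 1 end.

(** Each level of loop nesting contributes one factor [Z.+1]. *)
Lemma csteps_leq Z c : csteps Z c <= csize c * Z.+1 ^ depth c.
Proof.
have weaken a d d' : d <= d' -> a * Z.+1 ^ d <= a * Z.+1 ^ d'.
  by move=> dd; rewrite leq_mul2l leq_pexp2l ?orbT.
elim: c => //= [c1 IH1 c2 IH2|_ c1 IH1 c2 IH2|_ _ b IH].
- by rewrite mulnDl leq_add // (leq_trans IH1, leq_trans IH2) // weaken // (leq_maxl, leq_maxr).
- rewrite mulSn mulnDl.
  have := leq_trans IH1 (weaken (csize c1) _ _ (leq_maxl _ (depth c2))).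
  have := leq_trans IH2 (weaken (csize c2) _ _ (leq_maxr (depth c1) _)).
  by have : 0 < Z.+1 ^ maxn (depth c1) (depth c2); [rewrite expn_gt0|lia].
- rewrite expnS; have : 0 < Z.+1 ^ depth b by rewrite expn_gt0.
  by move: IH; move: (csteps Z b) (csize b) (Z.+1 ^ depth b) => x y z; nia.
Qed.

Definition power : cmd :=
  Read 0 ;; Assign 1 (Plus (Var 0) (Lit 64)) ;; Assign 2 (Lit 1) ;;
  For 3 (Plus (Times (Lit 4) (Var 0)) (Lit 22)) (Assign 2 (Times (Var 2) (Var 1))) ;;
  Write (Var 2).

(** The output itself serves as the bound on all stored values, since the partial powers and the
    loop limit stay below it. *)
Lemma wp_power m (W := (m + 64) ^ (4 * m + 22)) :
  wp W (4 * m + 22) power (fun s => out s = [:: W]) (start [:: m]).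
Proof.
have e0 : 4 * m + 22 < W by apply: ltn_expl; lia.
have b0 : m + 64 <= W by rewrite -{1}[m + 64]expn1 leq_exp2l; lia.
apply: wp_seq; split=> /=; first by lia.
apply: wp_seq; apply: wp_assign => /=; first exact: b0.
apply: wp_seq; apply: wp_assign => /=; first by lia.
set s := setv _ _ _.
have bs : bounded W s.
  split=> // x /=; rewrite /update /=; do 3!(case: ifP => _; first by lia); done.
have [h0 h1 h2 h3] : [/\ sc s 0 = m, sc s 1 = m + 64, sc s 2 = 1 & out s = [::]] by [].
move: s bs h0 h1 h2 h3 => s bs h0 h1 h2 h3.
apply: wp_seq.
pose Inv i s' := sc s' 2 = (m + 64) ^ i.
apply: (@wp_for _ _ _ _ _ Inv); rewrite /= ?h0 //; first by lia.
  move=> i s' lti fs' bs' I; have s1 : sc s' 1 = m + 64 by rewrite (fr_sc fs').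
  apply: wp_assign; rewrite /= /update /= I s1 -expnSr //.
  by rewrite leq_exp2l //; lia.
by move=> s' fs' I; apply: wp_write; rewrite /= (fr_out fs') // h3 /update /= I.
Qed.

Lemma computable_power : computable (fun m => (m + 64) ^ (4 * m + 22)).
Proof.
exists (compile 0 power) => m.
have W64 : 64 <= (m + 64) ^ (4 * m + 22).
  by apply: leq_trans (_ : (m + 64) ^ 1 <= _); [rewrite expn1; lia|rewrite leq_exp2l; lia].
have [t [o [c /= oE _]]] := @wp_computes 40 _ _ power [:: m]
  (eq^~ [:: (m + 64) ^ (4 * m + 22)]) isT W64 isT (wp_power m).
by exists t; rewrite -oE.
Qed.

Lemma leq_exp_base a b e : a <= b -> a ^ e <= b ^ e.
Proof. by case: e => // e ab; rewrite leq_exp2r. Qed.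

Lemma isize_gt0 (I : instance) : 0 < isize I.
Proof. by rewrite /isize encodeE !big_cons. Qed.

(** Origin of the exponent: the loop nesting gives [Z ^ 3] and the crude bound [3 * (b * Z * s)] on
    [bitlen W] gives [b * Z], together [b ^ (4 * m + 17)]; a further [b ^ 5] absorbs the numerical
    constants. *)
Lemma cost_leq m s (b := m + 64) (Z := b ^ (m + 4)) (W := b * Z * 2 ^ s) :
  0 < s ->
  (8 * 40 + 8) * csteps Z solve * (4 * bitlen (W ^ 40)) + 1 <= b ^ (4 * m + 22) * s ^ 1.
Proof.
move=> s0; rewrite expn1.
have b64 : 64 <= b by rewrite /b; lia.
have Z0 : 0 < Z by rewrite /Z expn_gt0; lia.
have bW : bitlen W <= 3 * (b * Z * s).
  have bZ : bitlen (b * Z) <= b * Z by apply: bitlen_leq; [nia|apply: ltn_expl].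
  have b2 : bitlen (2 ^ s) <= s.+1 by apply: bitlen_leq => //; rewrite ltn_exp2l.
  apply: leq_trans (bitlenM _ _) _; apply: leq_trans (leq_add bZ b2) _.
  by have : 0 < b * Z by [nia]; move: (b * Z) => x; nia.
have bW40 : bitlen (W ^ 40) <= 40 * (3 * (b * Z * s)).
  by apply: leq_trans (bitlenX _ _) _ => //; rewrite leq_mul2l bW orbT.
have st : csteps Z solve <= 87 * (8 * Z ^ 3).
  apply: leq_trans (csteps_leq _ _) _.
  have -> : depth solve = 3 by [].
  have -> : csize solve = 87 by [].
  rewrite leq_mul2l /=; have -> : 8 * Z ^ 3 = (2 * Z) ^ 3 by rewrite expnMn.
  by rewrite leq_exp2r //; lia.
have -> : b ^ (4 * m + 22) = b ^ 5 * (b * (Z * Z ^ 3)).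
  by rewrite -(expnS Z) /Z -expnM -(expnS b) -expnD; congr expn; lia.
(* Here [328 = 8 * 40 + 8], 87 is [csize solve], 8 comes from [Z.+1 <= 2 * Z] cubed, 4 from the cost
   of a step, and [40 * 3] from [bitlen (W ^ 40)]. The 64 in [b] makes five factors enough. *)
have b5 : 328 * (87 * 8) * (4 * (40 * 3)) + 1 <= b ^ 5.
  apply: (@leq_trans (64 ^ 5)); last by rewrite leq_exp2r.
  by rewrite !expnS expn0; lia.
have X0 : 0 < b * (Z * Z ^ 3) * s by have : 0 < Z ^ 3 by [rewrite (expn_gt0 Z) Z0]; rewrite !muln_gt0 s0 Z0; lia.
apply: (@leq_trans (328 * (87 * (8 * Z ^ 3)) * (4 * (40 * (3 * (b * Z * s)))) + 1)).
  by rewrite leq_add2r; apply: leq_mul; rewrite leq_mul2l ?st ?bW40 ?orbT.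
rewrite -[X in _ <= X]mulnA; apply: leq_trans (leq_mul b5 (leqnn (b * (Z * Z ^ 3) * s))).
rewrite mulnDl mul1n leq_add //.
have -> : 328 * (87 * (8 * Z ^ 3)) * (4 * (40 * (3 * (b * Z * s)))) =
   328 * (87 * 8) * (4 * (40 * 3)) * (b * (Z * Z ^ 3) * s).
  by move: (Z ^ 3) => z; lia.
exact: leqnn.
Qed.

Theorem theorem9 :
  exists (f : nat -> nat) (P : program) (c : nat),
    computable f /\
    forall I : instance,
      exists (t : nat) (r : option (matching I)),
        computes_in P (encode I) t (encode_answer r) /\
        correct_answer r /\
        t <= f (ntas I) * isize I ^ c.
Proof.
exists (fun m => (m + 64) ^ (4 * m + 22)), (compile 0 solve), 1.
split; first exact: computable_power.
move=> I; set n := ncourses I; set m := ntas I; set s := isize I.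
(* In [Z], the factor [b ^ m] covers the candidates and [b ^ 4] the items. [W] has to exceed [Z] and
   also [m * 2 ^ s], a bound on sums of [m] utilities. *)
pose b := m + 64; pose Z := b ^ (m + 4); pose W := b * Z * 2 ^ s.
have Z0 : 0 < Z by rewrite expn_gt0 /b; lia.
have s2 : 0 < 2 ^ s by rewrite expn_gt0.
have bZ : b * Z <= W by rewrite /W leq_pmulr.
have W64 : 64 <= W by apply: leq_trans bZ; rewrite /b; nia.
have b64 : 64 <= b by rewrite /b; lia.
have sW : b * 2 ^ s <= W by rewrite /W mulnAC leq_pmulr.
(* 40 is the [esize] of the largest expression, the comparison of grade products in [check_pair]:
   four grade lookups of size 10. *)
have small_solve : small 40 solve by vm_compute.
have time t : t <= (8 * 40 + 8) * csteps Z solve * (4 * bitlen (W ^ 40)) + 1 ->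
    t <= (m + 64) ^ (4 * m + 22) * s ^ 1.
  by move=> le; apply: leq_trans le (cost_leq _ (isize_gt0 I)).
case: (leqP n m) => [nm|mn]; last first.
  (* Here [n] is not bounded in terms of [m], but as an input number it is below [2 ^ s]. *)
  have nW : n <= W.
    have : n < 2 ^ s by apply: mem_encode_lt; rewrite encodeE inE eqxx.
    by nia.
  have [t [o [run oE /time le]]] := wp_computes (S := 40) (Q := eq^~ [:: 0])
    isT W64 small_solve (@wp_solve_large W Z W64 n m (items I) mn nW).
  exists t, None; split; first by rewrite encodeE -[encode_answer None]oE.
  by split=> //= -[mu [/feasible_courses_leq]]; rewrite leqNgt mn.
(* The verdict is fixed on one canonical heap; it agrees with the verdict on the actual heap because
   [validP] equates both with [MEFE] of the candidate. *)
pose ok i := valid (fun a => if odd a then nth 0 (items I) a./2 else digit n i a./2) n m.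
have okP i : reflect (MEFE (candidate I i)) (ok i).
  by apply: validP => [t _|j]; rewrite ?addn1 /= mul2n ?odd_double ?doubleK ?uphalf_double.
have Zpow : b ^ 4 * b ^ m = Z by rewrite /Z addnC expnD.
have bm0 : 0 < b ^ m by rewrite expn_gt0; lia.
have b4Z : b ^ 4 <= Z by rewrite -Zpow leq_pmulr.
have sizeZ : size (items I) <= Z.
  apply: leq_trans b4Z; rewrite size_items -/n -/m.
  have mb : m <= b by rewrite /b; lia.
  have nmb : n * m <= b * b by apply: leq_mul => //; apply: leq_trans nm mb.
  have bb : 64 * b <= b * b by rewrite leq_mul2r b64 orbT.
  have b4 : 64 * (b * b) <= b ^ 4.
    by rewrite (expnM b 2 2) -!mulnn leq_mul2r; apply/orP; right; lia.
  by lia.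
have [||||||t [o [run sol /time le]]] := wp_computes (S := 40) (Q := solution n m ok)
    isT W64 small_solve (@wp_solve W Z W64 n m (2 ^ s) (items I) ok nm _ (size_items I) sizeZ
      _ _ (items_leq I) _ _ _).
- by apply: leq_trans bZ; rewrite leq_pmull //; lia.
- apply: leq_trans (_ : b ^ m <= _); last by rewrite -Zpow leq_pmull // expn_gt0; lia.
  by apply: leq_exp_base; rewrite /b; lia.
- by apply: leq_trans b4Z; rewrite /b !expnS expn0; nia.
- by nia.
- by rewrite /b in sW; nia.
- move=> h i Hd Hi; apply/idP/idP => H.
    exact/okP/(validP Hd Hi).
  exact/(validP Hd Hi)/okP.
case: sol => [[i [_ oki oE]]|[none oE]].
  exists t, (Some (candidate I i)); split; first by rewrite encodeE encode_candidate -oE.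
  by split=> //; apply/okP.
exists t, None; split; first by rewrite encodeE -[encode_answer None]oE.
split=> //= -[mu]; have [i iN ->] := candidate_surj mu.
by move/okP; apply/negP/none.
Qed.
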